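(* Let $S$ be a nonzero $\mathfrak g$-module (not necessarily weight) on which every element of $\mathfrak g^+$ acts locally nilpotently. Then: (i) The module $S$ contains a nonzero vector $v$ such that $\mathfrak g^+v=0$. (ii) If $S$ is simple at nonzero level, then $S$ is a highest weight module.
   Context: Notation: $\mathbb N$ = non-negative integers, $\mathbb Z_+$ = positive integers; everything is over $\mathbb C$; modules over Lie superalgebras are $\mathbb Z_2$-graded. The superconformal current algebra $\mathfrak g$ is the Lie superalgebra with basis $\{L_m,H_m,G_p,F_p,\mathbf c_1,\mathbf c_2,\mathbf c_3 : m\in\mathbb Z,\ p\in\mathbb Z+\frac12\}$, where $L_m,H_m,\mathbf c_i$ are even and $G_p,F_p$ are odd, with $\mathbf c_i$ central and $[L_m,L_n]=(m-n)L_{m+n}+\delta_{m+n,0}\frac{m^3-m}{12}\mathbf c_1$, $[L_m,H_n]=-nH_{m+n}+\delta_{m+n,0}(m^2+m)\mathbf c_2$, $[H_m,H_n]=m\delta_{m+n,0}\mathbf c_3$, $[L_m,G_p]=(\frac m2-p)G_{m+p}$, $[G_p,G_q]=2L_{p+q}+\frac13(p^2-\frac14)\delta_{p+q,0}\mathbf c_1$, $[L_m,F_p]=-(\frac m2+p)F_{m+p}$, $[F_p,F_q]=\delta_{p+q,0}\mathbf c_3$, $[G_p,F_q]=H_{p+q}+(2p+1)\delta_{p+q,0}\mathbf c_2$, $[H_m,G_p]=mF_{m+p}$, $[H_m,F_p]=0$. $\mathfrak g^+=\mathrm{span}\{L_n,H_n,G_r,F_r: n\in\mathbb Z_+,\ r\in\mathbb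 N+\frac12\}$. An element $x$ acts locally nilpotently on $V$ if for every $v\in V$ there is $n\in\mathbb Z_+$ with $x^nv=0$. A $\mathfrak g$-module has level $\ell$ if $\mathbf c_3$ acts as the scalar $\ell$. The Verma modules for $\mathfrak g$ are $\mathrm{Ind}_{\mathfrak g^{(0,0)}}^{\mathfrak g}\mathbb Cv$, where $\mathfrak g^{(0,0)}=\mathfrak g^+\oplus\mathrm{span}\{L_0,H_0,\mathbf c_1,\mathbf c_2,\mathbf c_3\}$, $\mathfrak g^+v=0$ and $L_0,H_0,\mathbf c_1,\mathbf c_2,\mathbf c_3$ act on $v$ by scalars $h,d,c,z,\ell\in\mathbb C$; a highest weight module is a nonzero quotient of a Verma module (equivalently, a module generated by such a vector). *)

(* Defs.v *)
From HB Require Import structures.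
From mathcomp Require Import all_boot all_order all_algebra.
From mathcomp Require Import finmap.
From mathcomp Require Import monalg.
From mathcomp Require Import reals complex.
From mathcomp Require Import ring.

Set Implicit Arguments.
Unset Strict Implicit.
Unset Printing Implicit Defensive.

Import GRing.Theory Num.Theory.
Local Open Scope ring_scope.

(* The parity is a boolean: [homog false] is the even part and [homog true]
   the odd part. *)
HB.mixin Record Lmodule_isSuperspace (K : fieldType) V of GRing.Lmodule K V := {
  homog : bool -> V -> Prop;
  homog0 : forall b, homog b 0;
  homogP : forall b (a : K) (u v : V),
    homog b u -> homog b v -> homog b (a *: u + v);
  homog_split : forall v : V,
    exists v0 v1 : V, [/\ homog false v0, homog true v1 & v = v0 + v1];
  homog_trivI : forall v : V, homog false v -> homog true v -> v = 0
}.

#[short(type="superspaceType")]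
HB.structure Definition Superspace (K : fieldType) :=
  {V of GRing.Lmodule K V & Lmodule_isSuperspace K V}.

HB.mixin Record Superspace_isLieSuperalgebra (K : fieldType) g
    of Superspace K g := {
  bracket : g -> g -> g;
  bracketPl : forall (a : K) (x y z : g),
    bracket (a *: x + y) z = a *: bracket x z + bracket y z;
  bracketPr : forall (a : K) (x y z : g),
    bracket z (a *: x + y) = a *: bracket z x + bracket z y;
  bracket_homog : forall (b c : bool) (x y : g),
    homog b x -> homog c y -> homog (b (+) c) (bracket x y);
  bracket_skew : forall (b c : bool) (x y : g),
    homog b x -> homog c y ->
    bracket x y = - ((-1) ^+ (b && c) *: bracket y x);
  bracket_jacobi : forall (b c : bool) (x y z : g),
    homog b x -> homog c y ->
    bracket x (bracket y z) =
      bracket (bracket x y) z + (-1) ^+ (b && c) *: bracket y (bracket x z)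
}.

#[short(type="lieSuperalgType")]
HB.structure Definition LieSuperalgebra (K : fieldType) :=
  {g of Superspace K g & Superspace_isLieSuperalgebra K g}.

HB.mixin Record Superspace_isLieModule (K : fieldType)
    (g : lieSuperalgType K) V of Superspace K V := {
  act : g -> V -> V;
  actPl : forall (a : K) (x y : g) (v : V),
    act (a *: x + y) v = a *: act x v + act y v;
  actPr : forall (a : K) (x : g) (u v : V),
    act x (a *: u + v) = a *: act x u + act x v;
  act_homog : forall (b c : bool) (x : g) (v : V),
    homog b x -> homog c v -> homog (b (+) c) (act x v);
  act_bracket : forall (b c : bool) (x y : g) (v : V),
    homog b x -> homog c y ->
    act (bracket x y) v =
      act x (act y v) - (-1) ^+ (b && c) *: act y (act x v)
}.

#[short(type="lieModType")]
HB.structure Definition LieModule (K : fieldType) (g : lieSuperalgType K) :=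
  {V of Superspace K V & Superspace_isLieModule K g V}.

Section LieModuleTheory.
Variables (K : fieldType) (g : lieSuperalgType K) (V : lieModType g).

Definition locally_nilpotent (x : g) : Prop :=
  forall v : V, exists n : nat, (0 < n)%N /\ iter n (act x) v = 0.

(* Submodules are graded: the third clause says that a submodule contains the
   homogeneous components of its elements. *)
Definition submodule (W : V -> Prop) : Prop :=
  [/\ W 0,
      forall (a : K) (u v : V), W u -> W v -> W (a *: u + v),
      forall v0 v1 : V, homog false v0 -> homog true v1 ->
        W (v0 + v1) -> W v0 /\ W v1
    & forall (x : g) (v : V), W v -> W (act x v)].

Definition nonzero_module : Prop := exists v : V, v <> 0.

Definition simple_module : Prop :=
  nonzero_module /\
  forall W : V -> Prop, submodule W ->
    (forall v, W v -> v = 0) \/ (forall v, W v).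

Definition generated_by (v : V) : Prop :=
  forall W : V -> Prop, submodule W -> W v -> forall u, W u.

End LieModuleTheory.

Arguments locally_nilpotent {K g} V x.
Arguments nonzero_module {K g} V.
Arguments simple_module {K g} V.

(* Half-integers are encoded by integers: [genG k] and [genF k] stand for
   G_(k + 1/2) and F_(k + 1/2). *)
Inductive scgen :=
  | genL of int | genH of int | genG of int | genF of int
  | genC1 | genC2 | genC3.

Section ScgenChoice.

Let code : Type := (int + int + (int + int) + 'I_3)%type.

Let encode (i : scgen) : code := match i with
  | genL m => inl (inl (inl m)) | genH m => inl (inl (inr m))
  | genG k => inl (inr (inl k)) | genF k => inl (inr (inr k))
  | genC1 => inr 0 | genC2 => inr 1 | genC3 => inr 2%:R
  end.

Let decode (c : code) : scgen := match c with
  | inl (inl (inl m)) => genL m | inl (inl (inr m)) => genH m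
  | inl (inr (inl k)) => genG k | inl (inr (inr k)) => genF k
  | inr i => if val i is 0%N then genC1 else if val i is 1%N then genC2 else genC3
  end.

Let encodeK : cancel encode decode.
Proof. by case. Qed.

HB.instance Definition _ := Choice.copy scgen (can_type encodeK).

End ScgenChoice.

Definition scparity (i : scgen) : bool :=
  match i with genG _ | genF _ => true | _ => false end.

Definition scpositive (i : scgen) : bool :=
  match i with
  | genL m | genH m => 0 < m
  | genG k | genF k => 0 <= k
  | _ => false
  end.

Definition scalg (K : fieldType) := {malg K[scgen]}.

HB.instance Definition _ (K : fieldType) := 
  GRing.Lmodule.copy (scalg K) {malg K[scgen]}.

Section SuperconformalCurrent.
Variable K : numFieldType.
Local Notation g := (scalg K).

Definition half (k : int) : K := k%:~R + 2^-1.

(* The bracket of the basis vectors with labels [i] and [j], where [bas] is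
   the basis.  For p = k + 1/2 and q = l + 1/2 one has p + q = k + l + 1. *)
Definition gbr (V : lmodType K) (bas : scgen -> V) (i j : scgen) : V :=
  match i, j with
  | genL m, genL n => (m - n)%:~R *: bas (genL (m + n))
      + ((m + n == 0)%:R * ((m%:~R ^+ 3 - m%:~R) / 12%:R)) *: bas genC1
  | genL m, genH n => - n%:~R *: bas (genH (m + n))
      + ((m + n == 0)%:R * (m%:~R ^+ 2 + m%:~R)) *: bas genC2
  | genH n, genL m => n%:~R *: bas (genH (m + n))
      - ((m + n == 0)%:R * (m%:~R ^+ 2 + m%:~R)) *: bas genC2
  | genH m, genH n => ((m + n == 0)%:R * m%:~R) *: bas genC3
  | genL m, genG k => (m%:~R / 2 - half k) *: bas (genG (m + k))
  | genG k, genL m => - (m%:~R / 2 - half k) *: bas (genG (m + k))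
  | genG k, genG l => 2 *: bas (genL (k + l + 1))
      + ((k + l + 1 == 0)%:R * (3^-1 * (half k ^+ 2 - 4^-1))) *: bas genC1
  | genL m, genF k => - (m%:~R / 2 + half k) *: bas (genF (m + k))
  | genF k, genL m => (m%:~R / 2 + half k) *: bas (genF (m + k))
  | genF k, genF l => ((k + l + 1 == 0)%:R : K) *: bas genC3
  | genG k, genF l | genF l, genG k => bas (genH (k + l + 1))
      + ((k + l + 1 == 0)%:R * (2 * half k + 1)) *: bas genC2
  | genH m, genG k => m%:~R *: bas (genF (m + k))
  | genG k, genH m => - m%:~R *: bas (genF (m + k))
  | _, _ => 0
  end.

Section BasisIdentities.
Variables (V : lmodType K) (bas : scgen -> V).
Variables (br : V -> V -> V) (co : V -> K).
Hypothesis brPl : forall a x y z, br (a *: x + y) z = a *: br x z + br y z.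
Hypothesis brPr : forall a x y z, br z (a *: x + y) = a *: br z x + br z y.
Hypothesis brU : forall i j, br (bas i) (bas j) = gbr bas i j.
Hypothesis coP : forall a x y, co (a *: x + y) = a * co x + co y.

Let brDl x y z : br (x + y) z = br x z + br y z.
Proof. by have := brPl 1 x y z; rewrite !scale1r. Qed.

Let brDr x y z : br z (x + y) = br z x + br z y.
Proof. by have := brPr 1 x y z; rewrite !scale1r. Qed.

Let br0l z : br 0 z = 0.
Proof. by apply: (@addrI _ (br 0 z)); rewrite -brDl !addr0. Qed.

Let br0r z : br z 0 = 0.
Proof. by apply: (@addrI _ (br z 0)); rewrite -brDr !addr0. Qed.

Let brZl a x z : br (a *: x) z = a *: br x z.
Proof. by rewrite -[a *: x]addr0 brPl br0l addr0. Qed.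

Let brZr a x z : br z (a *: x) = a *: br z x.
Proof. by rewrite -[a *: x]addr0 brPr br0r addr0. Qed.

Lemma br_skew0l s y : br 0 y = - (s *: br y 0).
Proof. by rewrite br0l br0r scaler0 oppr0. Qed.

Lemma br_skewPl s a x x' y :
  br x y = - (s *: br y x) -> br x' y = - (s *: br y x') ->
  br (a *: x + x') y = - (s *: br y (a *: x + x')).
Proof.
move=> hx hx'; rewrite brPl hx hx' brPr scalerDr opprD scalerN !scalerA.
by rewrite mulrC.
Qed.

Lemma br_skewPr s a x y y' :
  br x y = - (s *: br y x) -> br x y' = - (s *: br y' x) ->
  br x (a *: y + y') = - (s *: br (a *: y + y') x).
Proof.
move=> hy hy'; rewrite brPr hy hy' brPl scalerDr opprD scalerN !scalerA.
by rewrite mulrC.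
Qed.

Let jacobi s x y z := br x (br y z) = br (br x y) z + s *: br y (br x z).

Lemma br_jacobi0l s y z : jacobi s 0 y z.
Proof. by rewrite /jacobi !br0l br0r scaler0 addr0. Qed.

Lemma br_jacobi0m s x z : jacobi s x 0 z.
Proof. by rewrite /jacobi !br0l !br0r br0l scaler0 addr0. Qed.

Lemma br_jacobi0r s x y : jacobi s x y 0.
Proof. by rewrite /jacobi !br0r scaler0 addr0. Qed.

Lemma br_jacobiPl s a x x' y z :
  jacobi s x y z -> jacobi s x' y z -> jacobi s (a *: x + x') y z.
Proof.
rewrite /jacobi => hx hx'; rewrite !(brPl, brPr) hx hx' !scalerDr !scalerA.
by rewrite addrACA (mulrC s).
Qed.

Lemma br_jacobiPm s a x y y' z :
  jacobi s x y z -> jacobi s x y' z -> jacobi s x (a *: y + y') z.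
Proof.
rewrite /jacobi => hy hy'; rewrite !(brPl, brPr) hy hy' !scalerDr !scalerA.
by rewrite addrACA (mulrC s).
Qed.

Lemma br_jacobiPr s a x y z z' :
  jacobi s x y z -> jacobi s x y z' -> jacobi s x y (a *: z + z').
Proof.
rewrite /jacobi => hz hz'; rewrite !(brPl, brPr) hz hz' !scalerDr !scalerA.
by rewrite addrACA (mulrC s).
Qed.

Let coD x y : co (x + y) = co x + co y.
Proof. by have := coP 1 x y; rewrite scale1r mul1r. Qed.

Let co0 : co 0 = 0.
Proof. by apply: (@addrI _ (co 0)); rewrite -coD !addr0. Qed.

Let coZ a x : co (a *: x) = a * co x.
Proof. by rewrite -[a *: x]addr0 coP co0 addr0. Qed.

Let coN x : co (- x) = - co x.
Proof. by rewrite -scaleN1r coZ mulN1r. Qed.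

Let intr_subst k a : a = 0 -> k%:~R = (k - a)%:~R :> K.
Proof. by move=> ->; rewrite subr0. Qed.

(* Give the same argument to all the occurrences of [X]. *)
Ltac sc_norm X := try match goal with |- context [X ?a] =>
  repeat match goal with |- context [X ?b] =>
    lazymatch b with a => fail | _ => rewrite (_ : b = a); last by ring end
  end end.

(* Decide whether the total degree vanishes; if so, solve it for [k]. *)
Ltac sc_delta k := try match goal with |- context [?a == 0] =>
  repeat match goal with |- context [?b == 0] =>
    lazymatch b with a => fail | _ => rewrite (_ : b = a); last by ring end
  end;
  case: (eqVneq a 0) => [/(intr_subst k)|_] end.

Ltac sc_ring :=
  rewrite /half /= ?mulr0n ?mulr1n ?(intrD, mulrNz, mulr1z);
  first [move=> -> | move=> _ | idtac];
  first [ring | field; by rewrite ?pnatr_eq0].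

Lemma gbr_skew_co i j :
  co (gbr bas i j)
    = co (- ((-1) ^+ (scparity i && scparity j) *: gbr bas j i)).
Proof.
case: i => [m|m|m|m|||]; case: j => [n|n|n|n|||];
  rewrite /= ?expr0 ?expr1 ?scaler0 ?oppr0 // ?(coD, coN, coZ).
all: sc_norm genL; sc_norm genH; sc_norm genG; sc_norm genF; sc_delta n.
all: sc_ring.
Qed.

Lemma gbr_jacobi_co i j k :
  co (br (bas i) (gbr bas j k)) = co (br (gbr bas i j) (bas k)
    + (-1) ^+ (scparity i && scparity j) *: br (bas j) (gbr bas i k)).
Proof.
case: i => [m|m|m|m|||]; case: j => [n|n|n|n|||]; case: k => [p|p|p|p|||];
  rewrite /= ?br0l ?br0r ?scaler0 ?addr0 //;
  rewrite -?scaleNr ?(brDl, brDr) ?(brZl, brZr) ?brU /=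
    ?scaler0 ?addr0 ?expr0 ?expr1 //;
  rewrite ?(coD, coN, coZ, co0).
all: sc_norm genL; sc_norm genH; sc_norm genG; sc_norm genF; sc_delta p.
all: sc_ring.
Qed.

End BasisIdentities.

Definition scbas (i : scgen) : g := << i >>.

Definition lext (V : lmodType K) (f : scgen -> V) (x : g) : V :=
  \sum_(i <- msupp x) x@_i *: f i.

Definition scbracket (x y : g) : g := lext (fun i => lext (gbr scbas i) y) x.

Definition schomog (b : bool) (x : g) : Prop :=
  forall i, i \in msupp x -> scparity i = b.

Lemma lextEw (V : lmodType K) (f : scgen -> V) (x : g) (d : {fset scgen}) :
  (msupp x `<=` d)%fset -> lext f x = \sum_(i <- d) x@_i *: f i.
Proof.
move=> sxd; rewrite /lext; apply: big_fset_incl => // i _.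
by move/mcoeff_outdom ->; rewrite scale0r.
Qed.

Lemma lextP (V : lmodType K) (f : scgen -> V) (a : K) (x y : g) :
  lext f (a *: x + y) = a *: lext f x + lext f y.
Proof.
pose d := (msupp (a *: x + y) `|` (msupp x `|` msupp y))%fset.
have sd z : (msupp z `<=` d)%fset -> lext f z = \sum_(i <- d) z@_i *: f i.
  exact: lextEw.
rewrite (sd (_ + _)) ?(sd x) ?(sd y) //;
  do ?by apply/fsubsetP => k kz; rewrite !in_fsetU kz ?orbT.
rewrite scaler_sumr -big_split /=; apply: eq_bigr => i _.
by rewrite mcoeffD mcoeffZ scalerDl scalerA.
Qed.

Lemma lextU (V : lmodType K) (f : scgen -> V) i : lext f (scbas i) = f i.
Proof.
rewrite (@lextEw _ f _ [fset i]%fset) ?msuppU_le // big_seq_fset1.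
by rewrite mcoeffUU scale1r.
Qed.

Lemma lext_fP (V : lmodType K) (f h : scgen -> V) (a : K) (x : g) :
  lext (fun i => a *: f i + h i) x = a *: lext f x + lext h x.
Proof.
rewrite /lext scaler_sumr -big_split /=; apply: eq_bigr => i _.
by rewrite scalerDr !scalerA mulrC.
Qed.

Lemma scbracketPl a x y z :
  scbracket (a *: x + y) z = a *: scbracket x z + scbracket y z.
Proof. exact: lextP. Qed.

Lemma scbracketPr a x y z :
  scbracket z (a *: x + y) = a *: scbracket z x + scbracket z y.
Proof.
by rewrite /scbracket -lext_fP; apply: eq_bigr => i _; rewrite lextP.
Qed.

Lemma scbracketU i j : scbracket (scbas i) (scbas j) = gbr scbas i j.
Proof. by rewrite /scbracket !lextU. Qed.

Lemma scbracket0l z : scbracket 0 z = 0.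
Proof. by rewrite /scbracket /lext msupp0 big_seq_fset0. Qed.

Lemma scbracket0r z : scbracket z 0 = 0.
Proof.
rewrite /scbracket /lext big1 // => i _.
by rewrite msupp0 big_seq_fset0 scaler0.
Qed.

Lemma scbracketDl x y z : scbracket (x + y) z = scbracket x z + scbracket y z.
Proof. by rewrite -[x]scale1r scbracketPl !scale1r. Qed.

Lemma scbracketDr x y z : scbracket z (x + y) = scbracket z x + scbracket z y.
Proof. by rewrite -[x]scale1r scbracketPr !scale1r. Qed.

Lemma scbracketZl a x z : scbracket (a *: x) z = a *: scbracket x z.
Proof. by rewrite -[a *: x]addr0 scbracketPl scbracket0l addr0. Qed.

Lemma scbracketZr a x z : scbracket z (a *: x) = a *: scbracket z x.
Proof. by rewrite -[a *: x]addr0 scbracketPr scbracket0r addr0. Qed.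

Lemma schomog0 b : schomog b 0.
Proof. by move=> i; rewrite msupp0 inE. Qed.

Lemma schomogP b a x y : schomog b x -> schomog b y -> schomog b (a *: x + y).
Proof.
move=> hx hy i /(fsubsetP (msuppD_le _ _)); rewrite in_fsetU => /orP[].
  by move/(fsubsetP (msuppZ_le _ _))/hx.
exact: hy.
Qed.

Lemma schomogU i : schomog (scparity i) (scbas i).
Proof. by move=> j /(fsubsetP msuppU_le); rewrite inE => /eqP ->. Qed.

Lemma schomog_ind b (P : g -> Prop) :
  P 0 -> (forall a x y, P x -> P y -> P (a *: x + y)) ->
  (forall i, scparity i = b -> P (scbas i)) -> forall x, schomog b x -> P x.
Proof.
move=> P0 PD PU x hx; rewrite [x]monalgE big_seq.
apply: (big_ind P) => // [u v Pu Pv|i ix].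
  by rewrite -[u]scale1r; apply: PD.
rewrite (_ : << _ *g i >> = x@_i *: scbas i + 0); last first.
  apply/malgP => k.
  by rewrite addr0 mcoeffZ !mcoeffU mulr_natr.
by apply: PD => //; apply/PU/hx.
Qed.

Lemma scalg_ind (P : g -> Prop) :
  P 0 -> (forall a x y, P x -> P y -> P (a *: x + y)) ->
  (forall i, P (scbas i)) -> forall x, P x.
Proof.
move=> P0 PD PU x; rewrite [x]monalgE big_seq.
apply: (big_ind P) => // [u v Pu Pv|i ix].
  by rewrite -[u]scale1r; apply: PD.
rewrite (_ : << _ *g i >> = x@_i *: scbas i + 0); last first.
  by apply/malgP => k; rewrite addr0 mcoeffZ !mcoeffU mulr_natr.
exact: PD.
Qed.

Lemma schomog_split x :
  exists x0 x1, [/\ schomog false x0, schomog true x1 & x = x0 + x1].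
Proof.
elim/scalg_ind: x => [|a x y|i].
- by exists 0, 0; rewrite addr0; split=> //; apply: schomog0.
- move=> [x0 [x1 [hx0 hx1 ->]]] [y0 [y1 [hy0 hy1 ->]]].
  exists (a *: x0 + y0), (a *: x1 + y1); split; [exact: schomogP | exact: schomogP|].
  by rewrite scalerDr addrACA.
- have := @schomogU i; case: (scparity i) => hi.
    by exists 0, (scbas i); rewrite add0r; split=> //; apply: schomog0.
  by exists (scbas i), 0; rewrite addr0; split=> //; apply: schomog0.
Qed.

Lemma schomog_trivI x : schomog false x -> schomog true x -> x = 0.
Proof.
move=> h0 h1; apply/malgP => i; rewrite mcoeff0; case: msuppP => // ix.
by have := h0 i ix; rewrite h1.
Qed.

HB.instance Definition _ := Lmodule_isSuperspace.Build K g
  schomog0 schomogP schomog_split schomog_trivI.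

Lemma schomogZU b (a : K) i : scparity i = b -> schomog b (a *: scbas i).
Proof.
move=> <-; rewrite -[_ *: _]addr0; apply: schomogP; last exact: schomog0.
exact: schomogU.
Qed.

Lemma schomogD b x y : schomog b x -> schomog b y -> schomog b (x + y).
Proof. by move=> hx hy; rewrite -[x]scale1r; apply: schomogP. Qed.

Lemma gbr_homog i j : schomog (scparity i (+) scparity j) (gbr scbas i j).
Proof.
case: i => [m|m|k|k|||]; case: j => [n|n|l|l|||] /=;
  rewrite -?scaleNr; do ?[exact: schomog0 | exact: schomogZU
    | apply: schomogD | exact: schomogU].
Qed.

Lemma scbracket_homog b c x y :
  schomog b x -> schomog c y -> schomog (b (+) c) (scbracket x y).
Proof.
move=> hx hy; elim/schomog_ind: x / hx => [|a x x' hx hx'|i <-].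
- by rewrite scbracket0l; apply: schomog0.
- by rewrite scbracketPl; apply: schomogP.
elim/schomog_ind: y / hy => [|a y y' hy hy'|j <-].
- by rewrite scbracket0r; apply: schomog0.
- by rewrite scbracketPr; apply: schomogP.
by rewrite scbracketU; apply: gbr_homog.
Qed.

Lemma mcoeffP u a (x y : g) : (a *: x + y)@_u = a * x@_u + y@_u.
Proof. by rewrite mcoeffD mcoeffZ. Qed.

Lemma scbracket_skew b c x y :
  schomog b x -> schomog c y ->
  scbracket x y = - ((-1) ^+ (b && c) *: scbracket y x).
Proof.
move=> hx hy; elim/schomog_ind: x / hx => [|a x x' hx hx'|i <-].
- exact: (@br_skew0l g scbracket scbracketPl scbracketPr).
- exact: (@br_skewPl g scbracket scbracketPl scbracketPr _ _ _ _ _ hx hx').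
elim/schomog_ind: y / hy => [|a y y' hy hy'|j <-].
- by rewrite scbracket0l scbracket0r scaler0 oppr0.
- exact: (@br_skewPr g scbracket scbracketPl scbracketPr _ _ _ _ _ hy hy').
rewrite !scbracketU; apply/malgP => u.
exact: (@gbr_skew_co g scbas (mcoeff u) (mcoeffP u)).
Qed.

Lemma scbracket_jacobi b c x y z :
  schomog b x -> schomog c y ->
  scbracket x (scbracket y z) = scbracket (scbracket x y) z
    + (-1) ^+ (b && c) *: scbracket y (scbracket x z).
Proof.
move=> hx hy; elim/schomog_ind: x / hx => [|a x x' hx hx'|i <-].
- exact: (@br_jacobi0l g scbracket scbracketPl scbracketPr).
- exact: (@br_jacobiPl g scbracket scbracketPl scbracketPr _ _ _ _ _ _ hx hx').
elim/schomog_ind: y / hy => [|a y y' hy hy'|j <-].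
- exact: (@br_jacobi0m g scbracket scbracketPl scbracketPr).
- exact: (@br_jacobiPm g scbracket scbracketPl scbracketPr _ _ _ _ _ _ hy hy').
elim/scalg_ind: z => [|a z z' hz hz'|k].
- exact: (@br_jacobi0r g scbracket scbracketPr).
- exact: (@br_jacobiPr g scbracket scbracketPr _ _ _ _ _ _ hz hz').
rewrite !scbracketU; apply/malgP => u.
exact: (@gbr_jacobi_co g scbas scbracket (mcoeff u) scbracketPl scbracketPr
  scbracketU (mcoeffP u)).
Qed.

HB.instance Definition _ := Superspace_isLieSuperalgebra.Build K g
  scbracketPl scbracketPr scbracket_homog scbracket_skew scbracket_jacobi.

(* [msupp x] is the finite set of the basis labels occurring in [x]. *)
Definition gplus (x : g) : Prop := forall i, i \in msupp x -> scpositive i.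

Section Modules.
Variable V : lieModType g.

Definition has_level (l : K) : Prop :=
  forall v : V, act (scbas genC3) v = l *: v.

Definition singular_vector (v : V) : Prop :=
  v <> 0 /\ forall x : g, gplus x -> act x v = 0.

(* In the category of graded modules the generator of a Verma module is
   homogeneous, of either parity. *)
Definition highest_weight_vector (h d c z l : K) (v : V) : Prop :=
  [/\ singular_vector v,
      exists b : bool, homog b v
    & [/\ act (scbas (genL 0)) v = h *: v,
          act (scbas (genH 0)) v = d *: v,
          act (scbas genC1) v = c *: v,
          act (scbas genC2) v = z *: v
        & act (scbas genC3) v = l *: v]].

Definition highest_weight_module : Prop :=
  exists (h d c z l : K) (v : V),
    highest_weight_vector h d c z l v /\ generated_by v.

End Modules.

End SuperconformalCurrent.

Arguments has_level {K} V l.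
Arguments highest_weight_module {K} V.

(* Main.v *)
From HB Require Import structures.
Require Import Defs.
From mathcomp Require Import all_boot all_order all_algebra.
From mathcomp Require Import finmap reals complex.
From mathcomp Require Import boolp classical_sets cardinality.
From mathcomp Require Import ereal lebesgue_measure.
From mathcomp Require Import zify ring.

Set Implicit Arguments.
Unset Strict Implicit.
Unset Printing Implicit Defensive.

Import Order.TTheory GRing.Theory Num.Theory.
Local Open Scope ring_scope.

(** Part (i).  Being nilpotent, [L_1] kills some [v <> 0].  For [x] among [L_2],
    [H_1], [G_(3/2)], [F_(1/2)], the vector [L_1 ^ m (x v)] is a nonzero multiple of
    [x' v], where [x'] is the letter of the same type [m] places further; since
    [L_1] is nilpotent on [x v], all but finitely many positive letters kill [v]
    ([string_vanishes]).  The remaining ones are dealt with by decreasing degree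
    ([killed_descend]): a positive letter preserves the space of the vectors
    killed by the letters above it, since its brackets with them lie above
    it again, and being nilpotent there it has a kernel.

    Part (ii).  [H_0] and the [c_i] are central.  As [S] has countable dimension
    and the complex field is uncountable, they act by scalars
    ([central_scalar]).  The space killed by the positive letters is stable
    under [L_0], so it is enough to find an eigenvector of [L_0] in it: in the
    simple module [S] it is then a highest weight vector that generates.

    Take a homogeneous [v <> 0] killed by the positive letters, and suppose that
    the vectors [L_0 ^ n v] are linearly independent.  Then [L_0] behaves like an
    indeterminate, and the submodule generated by [v] like a Verma module of
    generic highest weight: the vectors [m L_0 ^ n v], for [m] an ordered monomial
    in the negative letters and [n] a natural number, are linearly independent
    ([pbw_independent]).  But [S] is simple, so [v] belongs to the submodule
    generated by [L_0 v], which is spanned by the vectors [m L_0 ^ (n + 1) v]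
    ([pbw_span]); this is a contradiction.  Hence some nonzero polynomial in [L_0]
    kills [v], and splitting it into linear factors gives the eigenvector.

    Independence is the generic nondegeneracy of the contravariant pairing,
    read off from a filtration.  Give height 1 to each [L_m] with [m <> 0] and
    each [G_p], height 2 to [L_0], and height 0 to the other letters.  Then a
    bracket has smaller height than the product, except that a letter and its
    dual produce [L_0] (for [L] and [G]) or [c_3] (for [H] and [F]), up to terms of
    smaller height ([lin_gbr], [gbr_dual]).  So modulo smaller height the
    positive letters act on ordered monomials as derivatives in the dual
    letters ([gact_dual_monomial]); in that sense distinct monomials of the same
    degree are orthogonal, whereas the pairing of a monomial with itself is a
    nonzero multiple of a power of [L_0] ([monomial_pairing]).  The multiple is
    nonzero because the level, which is what [H] and [F] contribute, is nonzero. *)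

(** * Gradings of the basis labels *)

(** Twice the conformal degree, so that the odd labels also get an integer. *)
Definition deg (i : scgen) : int := match i with
  | genL m | genH m => m * 2 | genG k | genF k => k * 2 + 1 | _ => 0 end.

(** The order of growth of a letter when [L_0] is large: in that limit the
    rescaled letters become free oscillators, and [L_m], [G_p] are of the order
    of the square root of [L_0]. *)
Definition height (i : scgen) : nat := match i with
  | genL m => if m == 0 then 2%N else 1%N
  | genG _ => 1%N | _ => 0%N end.

Definition dual (i : scgen) : scgen := match i with
  | genL m => genL (- m) | genH m => genH (- m)
  | genG k => genG (- k - 1) | genF k => genF (- k - 1) | _ => i end.

(** Among the labels of degree 0, only [L_0] is not central. *)
Definition central (i : scgen) : Prop := deg i = 0 /\ i <> genL 0.

Definition lin_closed (K : numFieldType) (V : lmodType K) (Q : V -> Prop) :=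
  Q 0 /\ forall a u v, Q u -> Q v -> Q (a *: u + v).

Section LinClosed.
Variables (K : numFieldType) (V : lmodType K) (Q : V -> Prop).
Hypothesis Qlin : lin_closed Q.

Lemma lin0 : Q 0. Proof. by case: Qlin. Qed.
Lemma linP a u v : Q u -> Q v -> Q (a *: u + v).
Proof. by case: Qlin => _; apply. Qed.
Lemma linD u v : Q u -> Q v -> Q (u + v).
Proof. by move=> ? ?; rewrite -[u]scale1r; apply: linP. Qed.
Lemma linZ a u : Q u -> Q (a *: u).
Proof. by move=> ?; rewrite -[a *: u]addr0; apply: linP => //; apply: lin0. Qed.
Lemma linN u : Q u -> Q (- u).
Proof. by move=> ?; rewrite -scaleN1r; apply: linZ. Qed.
Lemma linB u v : Q u -> Q v -> Q (u - v).
Proof. by move=> ? ?; apply: linD => //; apply: linN. Qed.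

(** All that the later arguments use of the bracket: it adds degrees, and it
    lowers the height except between dual letters. *)
Lemma lin_gbr (f : scgen -> V) i j :
  (forall k, deg k = deg i + deg j -> (height k <= height i + height j)%N ->
     (j <> dual i -> (height k < height i + height j)%N) -> Q (f k)) ->
  Q (gbr f i j).
Proof.
move=> Qf.
case: i Qf => [m|m|m|m|||]; case: j => [n|n|n|n|||] Qf /=; rewrite -?scaleNr;
  try exact: lin0.
all: try apply: linD.
all: try (case: eqVneq => [e|_];
  last by rewrite /= ?mulr0n ?mul0r ?oppr0 ?scale0r; exact: lin0).
all: try apply: linZ.
all: apply: Qf => /=.
all: try (repeat case: ifP; lia).
all: try (move=> dj; exfalso; apply: dj; congr (_ _); lia).
move=> dj; have ? : n <> - m by move=> h; apply: dj; rewrite h.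
by repeat case: ifP; lia.
move=> dj; have ? : n <> - m - 1 by move=> h; apply: dj; rewrite h.
by repeat case: ifP; lia.
Qed.
End LinClosed.

(** * Words in the basis acting on a module *)

Section Action.
Variables (K : numFieldType) (S : lieModType (scalg K)).
Implicit Types (u v : S) (i j k : scgen) (a b c w : seq scgen).

Definition gact i u : S := act (scbas K i) u.

Definition wact w u : S := foldr gact u w.

Lemma homog_bas i : homog (scparity i) (scbas K i).
Proof. exact: schomogU. Qed.

Lemma act0l u : act (0 : scalg K) u = 0.
Proof.
have := actPl 1 (0 : scalg K) 0 u; rewrite !scale1r addr0 => h.
by apply: (@addrI _ (act (0 : scalg K) u)); rewrite addr0 -h.
Qed.

Lemma gactP i (r : K) u v : gact i (r *: u + v) = r *: gact i u + gact i v.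
Proof. exact: actPr. Qed.

Lemma gactD i u v : gact i (u + v) = gact i u + gact i v.
Proof. by have := gactP i 1 u v; rewrite !scale1r. Qed.

Lemma gact0 i : gact i 0 = 0.
Proof. by apply: (@addrI _ (gact i 0)); rewrite -gactD !addr0. Qed.

Lemma gactZ i (r : K) u : gact i (r *: u) = r *: gact i u.
Proof. by rewrite -[r *: u]addr0 gactP gact0 addr0. Qed.

Lemma wactP w (r : K) u v : wact w (r *: u + v) = r *: wact w u + wact w v.
Proof. by elim: w => //= i w ->; rewrite gactP. Qed.

Lemma wact0 w : wact w 0 = 0.
Proof. by elim: w => //= i w ->; rewrite gact0. Qed.

Lemma wactZ w (r : K) u : wact w (r *: u) = r *: wact w u.
Proof. by rewrite -[r *: u]addr0 wactP wact0 addr0. Qed.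

Lemma wactD w u v : wact w (u + v) = wact w u + wact w v.
Proof. by have := wactP w 1 u v; rewrite !scale1r. Qed.

Lemma wactB w u v : wact w (u - v) = wact w u - wact w v.
Proof. by rewrite -scaleN1r wactD wactZ scaleN1r. Qed.

Lemma wact_cat w w' u : wact (w ++ w') u = wact w (wact w' u).
Proof. exact: foldr_cat. Qed.

Lemma act_gbr i j u : act (gbr (scbas K) i j) u = gbr (fun k => gact k u) i j.
Proof.
have aP r x y : act (r *: x + y : scalg K) u = r *: act x u + act y u.
  exact: actPl.
have aD x y : act (x + y : scalg K) u = act x u + act y u.
  by have := aP 1 x y; rewrite !scale1r.
have aZ r x : act (r *: x : scalg K) u = r *: act x u.
  by rewrite -[r *: x]addr0 aP act0l addr0.
case: i => [m|m|k|k|||]; case: j => [n|n|l|l|||] /=; rewrite -?scaleNr;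
  by rewrite ?aD ?aZ ?act0l.
Qed.

Lemma gact_swap i j u : gact i (gact j u) =
  (-1) ^+ (scparity i && scparity j) *: gact j (gact i u)
    + gbr (fun k => gact k u) i j.
Proof.
rewrite -act_gbr -scbracketU.
rewrite (act_bracket _ _ _ _ u (@homog_bas i) (@homog_bas j)).
by rewrite addrC subrK.
Qed.

Lemma gact_homog i (b : bool) u : homog b u -> homog (scparity i (+) b) (gact i u).
Proof. by move=> hu; exact: act_homog (@homog_bas i) hu. Qed.

(** Each transposition of the moving letter with its neighbour is an equality
    up to a sign and a bracket, in which the two letters merge into one. *)
Lemma move_letter (Q : S -> Prop) a i b c u : lin_closed Q ->
  (forall b1 j b2 k, b = b1 ++ j :: b2 -> deg k = deg i + deg j ->
     (height k <= height i + height j)%N ->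
     (j <> dual i -> (height k < height i + height j)%N) ->
     Q (wact (a ++ b1 ++ k :: b2 ++ c) u)) ->
  Q (wact (a ++ i :: b ++ c) u
     - (-1) ^+ (scparity i && odd (count scparity b)) *: wact (a ++ b ++ i :: c) u).
Proof.
move=> Qlin; elim: b a => [|j b IH] a Qmerge.
  by rewrite andbF scale1r subrr; apply: lin0.
have Qs := IH (rcons a j) _.
rewrite /= oddD oddb andb_addr.
set t := scparity i && scparity j; set s := _ && _ in Qs *.
have {}Qs : Q (wact (a ++ j :: i :: b ++ c) u
    - (-1) ^+ s *: wact (a ++ j :: b ++ i :: c) u).
  rewrite -!(cat_rcons j); apply: Qs => b1 j' b2 k eb dk hk hk'; rewrite cat_rcons.
  by apply: (Qmerge (j :: b1) j' b2 k) => //; rewrite eb.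
pose g := gbr (fun k => gact k (wact (b ++ c) u)) i j.
have Qg : Q (wact a g).
  apply: (lin_gbr (Q := fun y => Q (wact a y))).
    split=> [|r y z Qy Qz]; first by rewrite wact0; apply: lin0.
    by rewrite wactP; apply: linP.
  move=> k dk hk hk'; have := Qmerge [::] j b k erefl dk hk hk'.
  by rewrite wact_cat.
have -> : wact (a ++ i :: j :: b ++ c) u =
    (-1) ^+ t *: wact (a ++ j :: i :: b ++ c) u + wact a g.
  by rewrite !wact_cat /= gact_swap wactP.
rewrite signr_addb -scalerA addrAC -scalerBr.
exact: linP.
Qed.

(** ** Spans of words applied to a vector *)

(** The predicate on words makes the filtrations by length and by height
    instances of one notion. *)
Inductive wspan (P : seq scgen -> Prop) u : S -> Prop :=
| wspan0 : wspan P u 0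
| wspanS r w v : P w -> wspan P u v -> wspan P u (r *: wact w u + v).

Lemma wspan_lin P u : lin_closed (wspan P u).
Proof.
split; first exact: wspan0.
move=> r x y + sy; elim=> [|t w z Pw _ IH]; first by rewrite scaler0 add0r.
by rewrite scalerDr scalerA -addrA; apply: wspanS.
Qed.

Lemma wspan_word P u w : P w -> wspan P u (wact w u).
Proof. by move=> ?; rewrite -[wact _ _]scale1r -[_ *: _]addr0; do !constructor. Qed.

Lemma wspan_ind_lin P u (Q : S -> Prop) : lin_closed Q ->
  (forall w, P w -> Q (wact w u)) -> forall v, wspan P u v -> Q v.
Proof. by move=> Ql QP v; elim=> [|r w z /QP ? _ ?]; [apply: lin0 | apply: linP]. Qed.

Lemma wspan_sub (P P' : seq scgen -> Prop) u v :
  (forall w, P w -> P' w) -> wspan P u v -> wspan P' u v.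
Proof.
move=> PP'; apply: wspan_ind_lin; first exact: wspan_lin.
by move=> w /PP'; apply: wspan_word.
Qed.

Lemma wspan_wact P P' u a v : (forall w, P w -> P' (a ++ w)) ->
  wspan P u v -> wspan P' u (wact a v).
Proof.
move=> PP'; elim=> [|r w z Pw _ IH]; first by rewrite wact0; apply: wspan0.
by rewrite wactP -wact_cat; apply: wspanS => //; apply: PP'.
Qed.

(** The graded algebra of the filtration by length is supercommutative. *)
Lemma wact_perm u w w' : perm_eq w w' ->
  exists s : bool, wspan (fun x => size x < size w)%N u
                     (wact w u - (-1) ^+ s *: wact w' u).
Proof.
elim: w w' => [|i w IH] w' pw.
  have -> : w' = [::] by apply: perm_nilP; rewrite perm_sym.
  by exists false; rewrite scale1r subrr; apply: wspan0.
have: i \in w' by rewrite -(perm_mem pw) mem_head.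
move=> /path.splitPr iw'; case: iw' pw => a b pw.
have pab : perm_eq w (a ++ b).
  by rewrite -(perm_cons i) (perm_trans pw) // perm_catC /= perm_cons perm_catC.
have [s hs] := IH _ pab.
have szw : size w = (size a + size b)%N by rewrite (perm_size pab) size_cat.
pose t := scparity i && odd (count scparity a).
have ht : wspan (fun x => size x < (size w).+1)%N u
    (wact (i :: a ++ b) u - (-1) ^+ t *: wact (a ++ i :: b) u).
  apply: (@move_letter _ [::]) => [|a1 j a2 k ea _ _ _]; first exact: wspan_lin.
  by apply: wspan_word; rewrite szw ea /= !size_cat /= !size_cat; lia.
exists (s (+) t); rewrite signr_addb -scalerA /=.
have {ht} := linZ (wspan_lin _ _) ((-1) ^+ s) ht.
have {hs}: wspan (fun x => size x < size (i :: w))%N u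
    (gact i (wact w u - (-1) ^+ s *: wact (a ++ b) u)).
  exact: (wspan_wact (a := [:: i])) hs.
rewrite -scaleN1r !(gactD, gactZ) scaleN1r /= => hs ht.
have := linD (wspan_lin _ _) hs ht.
by rewrite scalerBr addrA subrK.
Qed.

End Action.

(** * Existence of a singular vector *)

Lemma scpositiveE i : scpositive i = (0 < deg i).
Proof. by case: i => //= m; lia. Qed.

(** A refinement of the degree that separates [L] from [H] and [G] from [F], so
    that the positive letters are totally ordered. *)
Definition rank (i : scgen) : nat :=
  (2 * `|deg i| + match i with genH _ | genF _ => 1 | _ => 0 end)%N.

Lemma rank_inj i j : scpositive i -> scpositive j -> rank i = rank j -> i = j.
Proof.
by case: i => //= m; case: j => //= n; rewrite /rank /= => *;
  first [congr (_ _); lia | exfalso; lia].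
Qed.

Lemma last_nonzero_iter (T : eqType) (z : T) (f : T -> T) v n :
  v != z -> iter n f v = z -> exists m, iter m f v != z /\ f (iter m f v) = z.
Proof.
elim: n => [|n IH] vz /= fz; first by rewrite fz eqxx in vz.
case: (eqVneq (iter n f v) z) => [/(IH vz)//|nz].
by exists n.
Qed.

Section Singular.
Variables (K : numFieldType) (S : lieModType (scalg K)).
Implicit Types (u v w : S) (i j k : scgen).

Definition killed d u := forall i, scpositive i -> (d <= rank i)%N -> gact i u = 0.

Hypothesis nil : forall i, scpositive i -> locally_nilpotent S (scbas K i).

(** The last nonzero vector among the iterates. *)
Lemma gact_kernel (Q : S -> Prop) i v : scpositive i ->
  (forall u, Q u -> Q (gact i u)) -> Q v -> v <> 0 ->
  exists u, [/\ Q u, u <> 0 & gact i u = 0].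
Proof.
move=> ip Qi Qv /eqP v0; have [n [_ nz]] := nil ip v.
have [m [m0 im]] := last_nonzero_iter v0 nz.
by exists (iter m (gact i) v); split=> //; [elim: m {m0 im} => //= m; apply: Qi | apply/eqP].
Qed.

(** The bracket with a positive letter raises the degree, hence the rank, so
    it ends among the letters that kill [u]. *)
Lemma killed_gact d i u : scpositive i -> rank i = d ->
  killed d.+1 u -> killed d.+1 (gact i u).
Proof.
move=> ip ri ku j jp rj; rewrite gact_swap ku // gact0 scaler0 add0r.
apply: (lin_gbr (Q := fun y => y = 0)) => [|k dk _ _].
  by split=> // r x y -> ->; rewrite scaler0 addr0.
rewrite !scpositiveE in ip jp; apply: ku; first by rewrite scpositiveE; lia.
by move: rj; rewrite /rank; case: j jp dk => //= m; case: k => //= n; lia.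
Qed.

Lemma killed_descend d v : killed d v -> v <> 0 ->
  exists u, u <> 0 /\ killed 0 u.
Proof.
elim: d v => [|d IH] v kv v0; first by exists v.
have [[i [ip ri]]|no] := pselect (exists i, scpositive i /\ rank i = d).
  have [u [ku u0 iu]] := gact_kernel ip (fun u => @killed_gact d i u ip ri) kv v0.
  apply: (IH u) => // j jp; rewrite leq_eqVlt => /orP[/eqP dj|]; last exact: ku.
  by rewrite (@rank_inj j i) // ri.
apply: (IH v) => // j jp; rewrite leq_eqVlt => /orP[/eqP dj|]; last exact: kv.
by case: no; exists j.
Qed.

(** When [L_1] kills [v], the vector [L_1 ^ m (x v)] equals [(ad L_1) ^ m (x) v], so
    the nilpotency of [L_1] on [x v] kills the tail of the string of [x]. *)
Lemma string_vanishes (f : nat -> scgen) (c : nat -> K) v :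
  gact (genL 1) v = 0 -> (forall n, c n != 0) ->
  (forall n, gbr (fun k => gact k v) (genL 1) (f n) = c n *: gact (f n.+1) v) ->
  exists N, forall n, (N <= n)%N -> gact (f n) v = 0.
Proof.
move=> v1 c0 cE.
have stp n : gact (genL 1) (gact (f n) v) = c n *: gact (f n.+1) v.
  by rewrite gact_swap v1 gact0 scaler0 add0r.
have itE m : iter m (gact (genL 1)) (gact (f 0) v)
    = (\prod_(n < m) c n) *: gact (f m) v.
  elim: m => [|m IH] /=; first by rewrite big_ord0 scale1r.
  by rewrite IH gactZ stp scalerA big_ord_recr.
have [N [_ /eqP]] := nil (isT : scpositive (genL 1)) (gact (f 0) v).
rewrite itE scaler_eq0 => /orP[/eqP p0|/eqP fN].
  have : \prod_(n < N) c n != 0 by apply/prodf_neq0 => n _.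
  by rewrite p0 eqxx.
exists N => n /subnK <-; elim: (n - N)%N => //= m IH; apply/eqP.
by have /eqP := stp (m + N)%N; rewrite IH gact0 eq_sym scaler_eq0 (negPf (c0 _)).
Qed.

Lemma natr_succ_neq0 n : - (n%:R + 1) != 0 :> K.
Proof. by rewrite oppr_eq0 natr1 pnatr_eq0. Qed.

Lemma exists_killed : nonzero_module S -> exists v, v <> 0 /\ killed 0 v.
Proof.
move=> [v0 v0n].
have [v [_ vn v1]] :=
  @gact_kernel (fun _ => True) (genL 1) v0 isT (fun _ _ => I) I v0n.
have [|n|NL hL] := @string_vanishes (fun n => genL (n%:Z + 2)) (fun n => - (n%:R + 1)) v v1.
- exact: natr_succ_neq0.
- rewrite /gbr (_ : (_ == 0) = false) ?mul0r ?scale0r ?addr0; last by lia.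
  congr (_ *: gact (genL _) v).
  by rewrite (_ : 1 - _ = - (n%:Z + 1)) ?mulrNz ?intrD; last lia.
have [|n|NH hH] := @string_vanishes (fun n => genH (n%:Z + 1)) (fun n => - (n%:R + 1)) v v1.
- exact: natr_succ_neq0.
- rewrite /gbr (_ : (_ == 0) = false) ?mul0r ?scale0r ?addr0; last by lia.
  congr (_ *: gact (genH _) v).
  by rewrite intrD.
have [|n|NG hG] := @string_vanishes (fun n => genG (n%:Z + 1)) (fun n => - (n%:R + 1)) v v1.
- exact: natr_succ_neq0.
- rewrite /gbr; congr (_ *: gact (genG _) v).
  by rewrite /Defs.half intrD; field.
have [|n|NF hF] := @string_vanishes (fun n => genF n%:Z) (fun n => - (n%:R + 1)) v v1.
- exact: natr_succ_neq0.
- rewrite /gbr; congr (_ *: gact (genF _) v).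
  by rewrite /Defs.half; field.
(* A letter of that rank lies beyond the start of the vanishing tail of its
   string: the rank is at most four times the index, plus a constant. *)
apply: (@killed_descend (4 * (NL + NH + NG + NF) + 20)%N v) => // i.
case: i => [m|m|m|m|||] m0; rewrite /rank /deg => rm; try discriminate m0;
  rewrite /scpositive in m0.
- have -> : m = ((absz m).-2)%:Z + 2 by lia.
  by apply: hL; lia.
- have -> : m = ((absz m).-1)%:Z + 1 by lia.
  by apply: hH; lia.
- have -> : m = ((absz m).-1)%:Z + 1 by lia.
  by apply: hG; lia.
- have -> : m = (absz m)%:Z by lia.
  by apply: hF; lia.
Qed.

Lemma lext_scbas (x : scalg K) : lext (scbas K) x = x.
Proof.
elim/scalg_ind: x => [|a x y hx hy|i]; [|by rewrite lextP hx hy|exact: lextU].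
have := lextP (scbas K) (-1) 0 0.
by rewrite scaler0 addr0 scaleN1r addNr.
Qed.

Lemma killed_gplus u : killed 0 u -> forall x : scalg K, gplus x -> act x u = 0.
Proof.
move=> ku x xp; rewrite -(lext_scbas x) /lext big_seq.
apply: (big_ind (fun y : scalg K => act y u = 0)) => [|y z hy hz|i ix].
- exact: act0l.
- by rewrite -[y]scale1r actPl hy hz scaler0 addr0.
- rewrite -[_ *: _]addr0 actPl act0l addr0 (_ : act _ u = 0) ?scaler0 //.
  by apply: ku => //; apply: xp.
Qed.
End Singular.

(** * Ordered monomials span *)

Definition gen_code (i : scgen) : nat * int := match i with
  | genL m => (0%N, m) | genH m => (1%N, m) | genG k => (2%N, k)
  | genF k => (3%N, k) | genC1 => (4%N, 0) | genC2 => (5%N, 0)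
  | genC3 => (6%N, 0) end.

Definition gen_decode (c : nat * int) : scgen := match c with
  | (0%N, m) => genL m | (1%N, m) => genH m | (2%N, k) => genG k
  | (3%N, k) => genF k | (4%N, _) => genC1 | (5%N, _) => genC2
  | _ => genC3 end.

Lemma gen_codeK : cancel gen_code gen_decode.
Proof. by case. Qed.

HB.instance Definition _ := CanIsCountable gen_codeK.

Definition key (i : scgen) : nat := choice.pickle i.

Lemma key_inj : injective key.
Proof. exact: pcan_inj choice.pickleK. Qed.

Definition key_le : rel scgen := relpre key leq.

Lemma key_le_total : total key_le.
Proof. by move=> i j; apply: leq_total. Qed.

Lemma key_le_trans : transitive key_le.
Proof. by move=> i j k; apply: leq_trans. Qed.

Lemma key_le_anti : antisymmetric key_le.
Proof. by move=> i j h; apply: key_inj; apply: anti_leq. Qed.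

(** The square of an odd letter is half its bracket with itself, so that odd
    letters need not be repeated. *)
Definition odd_free (m : seq scgen) :=
  forall i, scparity i -> (count_mem i m <= 1)%N.

Definition monomial (m : seq scgen) :=
  [/\ forall i, i \in m -> deg i < 0, sorted key_le m & odd_free m].

Definition pbw_word (w : seq scgen) :=
  exists m n, monomial m /\ w = m ++ nseq n (genL 0).

Section Span.
Variables (K : numFieldType) (S : lieModType (scalg K)) (v : S).
Implicit Types (u : S) (i j k : scgen) (w m : seq scgen).
Hypothesis kv : killed 0 v.
Hypothesis v_eigen : forall i, central i -> exists a : K, gact i v = a *: v.

Lemma lin_perm (Q : S -> Prop) w w' : lin_closed Q -> perm_eq w w' ->
  (forall x, (size x < size w)%N -> Q (wact x v)) ->
  Q (wact w' v) -> Q (wact w v).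
Proof.
move=> Ql pw Qs Qw'; have [s /(wspan_ind_lin Ql Qs) h] := wact_perm v pw.
by rewrite -[wact w v](subrK ((-1) ^+ s *: wact w' v)); apply: linD => //; apply: linZ.
Qed.

(** The straightening half of the Poincare-Birkhoff-Witt theorem, for the
    module generated by [v]: modulo shorter words the letters may be permuted,
    positive and central ones are absorbed by [v], and a repeated odd letter
    merges with itself. *)
Lemma pbw_span w : wspan pbw_word v (wact w v).
Proof.
have Ql := wspan_lin pbw_word v.
elim: {w}(size w).+1 {-2}w (ltnSn (size w)) => // n IH w; rewrite ltnS => wn.
have {}IH x : (size x < size w)%N -> wspan pbw_word v (wact x v).
  by move=> h; apply: IH; apply: leq_trans wn.
have sz_rem i : i \in w -> (size (rem i w) < size w)%N.
  by move=> iw; rewrite size_rem //; case: w iw {IH wn}.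
have [/hasP[i iw ip]|/hasPn nopos] := boolP (has scpositive w).
  apply: (@lin_perm _ _ (rem i w ++ [:: i])) => //.
    by rewrite (perm_trans (perm_to_rem iw)) // -cat1s perm_catC.
  by rewrite wact_cat /= kv // wact0; apply: wspan0.
have [/hasP[i iw /andP[/eqP i0 /eqP iL]]|/hasPn nocent] :=
    boolP (has (fun i => (deg i == 0) && (i != genL 0)) w).
  apply: (@lin_perm _ _ (rem i w ++ [:: i])) => //.
    by rewrite (perm_trans (perm_to_rem iw)) // -cat1s perm_catC.
  have [a ha] := v_eigen (conj i0 iL).
  by rewrite wact_cat /= ha wactZ; apply: linZ => //; apply: IH; apply: sz_rem.
have [[i [io ic]]|odd_w] :=
    pselect (exists i, scparity i /\ (1 < count_mem i w)%N).
  have iw : i \in w by rewrite -has_pred1 has_count ltnW.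
  have iw' : i \in rem i w.
    by rewrite -has_pred1 has_count count_rem iw /= eqxx subn_gt0.
  have pw : perm_eq w (i :: i :: rem i (rem i w)).
    by rewrite (perm_trans (perm_to_rem iw)) // perm_cons perm_to_rem.
  apply: (lin_perm Ql pw IH).
  rewrite /=; set y := wact _ _.
  have e : gact i (gact i y) = 2^-1 *: gbr (fun k => gact k y) i i.
    have h := gact_swap i i y; rewrite io expr1 scaleN1r in h.
    have -> : gbr (fun k => gact k y) i i = 2 *: gact i (gact i y).
      have := congr1 (+%R (gact i (gact i y))) h.
      by rewrite addNKr scaler_nat mulr2n.
    by rewrite scalerA mulVf ?scale1r // pnatr_eq0.
  rewrite e; apply: linZ => //; apply: lin_gbr => // k _ _ _.
  by apply: (IH (k :: _)); rewrite (perm_size pw).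
pose m := sort key_le [seq i <- w | deg i < 0].
pose l := [seq i <- w | predC (fun i => deg i < 0) i].
have pw : perm_eq w (m ++ nseq (size l) (genL 0)).
  rewrite -(perm_filterC (fun i => deg i < 0) w) perm_cat ?perm_sort //.
    by rewrite perm_sym perm_sort.
  have <- // : l = nseq (size l) (genL 0).
  apply/all_pred1P/allP => i; rewrite mem_filter /= => /andP[ni iw].
  have := nocent i iw; rewrite negb_and negbK orbC.
  have := nopos i iw; rewrite scpositiveE -leNgt => pi.
  by case: eqVneq => //= _; lia.
apply: (lin_perm Ql pw IH); apply: wspan_word; exists m, (size l); split=> //; split.
- by move=> i; rewrite mem_sort mem_filter => /andP[].
- exact: sort_sorted key_le_total _.
- move=> i io; rewrite leqNgt; apply/negP => ci; apply: odd_w; exists i.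
  split=> //; apply: (leq_trans ci); rewrite (permP pw) count_cat.
  exact: leq_addr.
Qed.
End Span.

(** * Ordered monomials are independent *)

Definition wdeg (w : seq scgen) : int := \sum_(i <- w) deg i.
Definition wheight (w : seq scgen) : nat := (\sum_(i <- w) height i)%N.

Lemma wdeg_cons i w : wdeg (i :: w) = deg i + wdeg w.
Proof. exact: big_cons. Qed.
Lemma wdeg_cat w w' : wdeg (w ++ w') = wdeg w + wdeg w'.
Proof. exact: big_cat. Qed.
Lemma wheight_cons i w : wheight (i :: w) = (height i + wheight w)%N.
Proof. exact: big_cons. Qed.
Lemma wheight_cat w w' : wheight (w ++ w') = (wheight w + wheight w')%N.
Proof. exact: big_cat. Qed.
Lemma wdeg_nil : wdeg [::] = 0. Proof. exact: big_nil. Qed.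
Lemma wheight_nil : wheight [::] = 0%N. Proof. exact: big_nil. Qed.
Lemma wdeg_L0 n : wdeg (nseq n (genL 0)) = 0.
Proof. by elim: n => [|n IH] /=; rewrite ?wdeg_nil ?wdeg_cons ?IH. Qed.
Lemma wheight_L0 n : wheight (nseq n (genL 0)) = n.*2.
Proof. by elim: n => [|n IH] /=; rewrite ?wheight_nil ?wheight_cons ?IH. Qed.
Definition wordE := (wdeg_cons, wdeg_cat, wdeg_nil, wdeg_L0,
  wheight_cons, wheight_cat, wheight_nil, wheight_L0).

Lemma wdeg_rem i m : i \in m -> wdeg m = deg i + wdeg (rem i m).
Proof. by move=> im; rewrite -wdeg_cons; apply/perm_big/perm_to_rem. Qed.

Lemma wheight_rem i m : i \in m -> wheight m = (height i + wheight (rem i m))%N.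
Proof. by move=> im; rewrite -wheight_cons; apply/perm_big/perm_to_rem. Qed.

Lemma deg_dual i : deg (dual i) = - deg i.
Proof. by case: i => //= m; lia. Qed.

Lemma height_dual i : height (dual i) = height i.
Proof. by case: i => //= m; rewrite oppr_eq0. Qed.

Lemma dualK : involutive dual.
Proof. by case=> //= m; congr (_ _); lia. Qed.

Lemma parity_dual i : scparity (dual i) = scparity i.
Proof. by case: i. Qed.

Lemma monomial_rem i m : monomial m -> monomial (rem i m).
Proof.
case=> mneg ms mo; split=> [j /mem_rem/mneg //||j /mo].
  exact: (subseq_sorted key_le_trans (rem_subseq _ _) ms).
by apply: leq_trans; rewrite leq_count_subseq ?rem_subseq.
Qed.

Lemma monomial_cons i m : monomial (i :: m) -> deg i < 0 /\ monomial m.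
Proof.
move=> im; have := monomial_rem i im; rewrite /= eqxx => mm.
by split=> //; case: im => + _ _; apply; apply: mem_head.
Qed.

Lemma monomial_perm_eq m m' : monomial m -> monomial m' -> perm_eq m m' -> m = m'.
Proof.
case=> _ ms _ [_ ms' _]; apply: sorted_eq ms ms'; first exact: key_le_trans.
exact: key_le_anti.
Qed.

(** In a sorted word the copies of the first letter come first. *)
Lemma monomial_head i m : monomial (i :: m) -> i \in m -> i :: rem i m = m.
Proof.
case: m => // j m imm ijm; have [_ + _] := imm; move=> /= /andP[ij js].
suff -> : i = j by rewrite eqxx.
apply: key_le_anti; rewrite ij /=.
move: ijm; rewrite inE => /predU1P[->|im]; first exact: leqnn.
by have /allP/(_ _ im) := order_path_min key_le_trans js.
Qed.

Lemma exists_max (T : eqType) (f : T -> nat) (s : seq T) x0 : x0 \in s ->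
  exists2 x, x \in s & forall y, y \in s -> (f y <= f x)%N.
Proof.
elim: s x0 => // a [|b s] IH x0 _.
  by exists a; rewrite ?mem_head // => y; rewrite inE => /eqP ->.
have [x xs xm] := IH b (mem_head _ _).
have [fxa|fax] := leqP (f x) (f a).
  exists a; first exact: mem_head.
  by move=> y; rewrite inE => /predU1P[-> //|/xm h]; apply: leq_trans fxa.
exists x; first by rewrite inE xs orbT.
by move=> y; rewrite inE => /predU1P[->|/xm //]; apply: ltnW.
Qed.

Section Independence.
Variables (K : numFieldType) (S : lieModType (scalg K)) (v : S).
Implicit Types (u : S) (i j k : scgen) (w m : seq scgen).
Hypothesis kv : killed 0 v.
Hypothesis v_eigen : forall i, central i -> exists a : K, gact i v = a *: v.
Variable l : K.
Hypothesis l_neq0 : l != 0.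
Hypothesis level : forall u, gact genC3 u = l *: u.

Definition power_below h w := exists2 n, w = nseq n (genL 0) & (n.*2 <= h)%N.

(** What the filtration says about a vector of degree [d] and height [h] in a
    module generated by [v], in the degrees where the module is understood:
    above [v] it is zero, and in the degree of [v] it is a polynomial in [L_0]. *)
Definition evaluates (d : int) h u :=
  (0 < d -> u = 0) /\ (d = 0 -> wspan (power_below h) v u).

Lemma evaluates_lin d h : lin_closed (evaluates d h).
Proof.
split; first by split=> // _; apply: wspan0.
move=> a x y [x1 x2] [y1 y2]; split=> d0; first by rewrite x1 // y1 // scaler0 addr0.
by apply: linP (x2 d0) (y2 d0); apply: wspan_lin.
Qed.

Lemma evaluates_le d h h' u : (h <= h')%N -> evaluates d h u -> evaluates d h' u.
Proof.
move=> hh [u1 u2]; split=> // /u2; apply: wspan_sub => w [n -> hn].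
by exists n => //; apply: leq_trans hh.
Qed.

(** A word of nonnegative degree that is not a power of [L_0] contains a
    positive or central letter; moving it to the right end, where [v] absorbs
    it, leaves shorter words of no greater height. *)
Lemma word_evaluates w : evaluates (wdeg w) (wheight w) (wact w v).
Proof.
elim: {w}(size w).+1 {-2}w (ltnSn (size w)) => // n IH w; rewrite ltnS => wn.
have [/hasP[i iw /andP[i0 /eqP iL]]|/hasPn none] :=
    boolP (has (fun i => (0 <= deg i) && (i != genL 0)) w).
  have [a [ha a0]] : exists a : K, gact i v = a *: v /\ (0 < deg i -> a = 0).
    move: i0; rewrite le_eqVlt => /orP[/eqP/esym i0|i0].
      by have [a ha] := v_eigen (conj i0 iL); exists a; rewrite i0.
    by exists 0; rewrite scale0r kv // scpositiveE.
  move: wn; case/path.splitPr: iw => w1 w2; rewrite size_cat /= => wn.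
  have El := evaluates_lin (wdeg (w1 ++ i :: w2)) (wheight (w1 ++ i :: w2)).
  set d := wdeg _ in El *; set h := wheight _ in El *.
  have : evaluates d h (wact (w1 ++ i :: w2 ++ [::]) v
    - (-1) ^+ (scparity i && odd (count scparity w2))
      *: wact (w1 ++ w2 ++ i :: [::]) v).
    apply: move_letter => // b1 j b2 k e dk hk _; rewrite cats0.
    have -> : d = wdeg (w1 ++ b1 ++ k :: b2).
      by rewrite /d e !wordE dk; lia.
    apply: evaluates_le; last first.
      by apply: IH; move: wn; rewrite e !size_cat /=; lia.
    by rewrite /h e !wordE; lia.
  rewrite cats0; set s := (-1) ^+ _ => Em.
  rewrite -[wact _ v](subrK (s *: wact (w1 ++ w2 ++ [:: i]) v)).
  apply: linD => //; apply: linZ => //.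
  rewrite catA wact_cat /= ha wactZ; have [di|di] := ltP 0 (deg i).
    by rewrite a0 // scale0r; apply: lin0.
  have {}di : deg i = 0 by lia.
  apply: linZ => //; have -> : d = wdeg (w1 ++ w2).
    by rewrite /d !wordE di; lia.
  apply: evaluates_le; last by apply: IH; rewrite size_cat; lia.
  by rewrite /h !wordE; lia.
have neg i : i \in w -> deg i < 0 \/ i = genL 0.
  by move=> /none; rewrite negb_and negbK -ltNge => /orP[->|/eqP]; [left|right].
have [w0|wn0] := boolP (all (pred1 (genL 0)) w).
  have /all_pred1P -> := w0; rewrite !wordE; split=> // _.
  by apply: wspan_word; exists (size w).
have : wdeg w < 0.
  move: neg wn0; elim: (w) => //= j x IHx neg.
  have hx i : i \in x -> deg i < 0 \/ i = genL 0.
    by move=> ix; apply: neg; rewrite inE ix orbT.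
  have xle : wdeg x <= 0.
    rewrite /wdeg big_seq; apply: sumr_le0 => i /hx[/ltW //|-> //].
  rewrite negb_and wdeg_cons; have [dj|-> /=] := neg j (mem_head _ _); first by lia.
  by rewrite add0r; apply: IHx.
by split=> ?; lia.
Qed.

Definition lower (d : int) h w := wdeg w = d /\ (wheight w < h)%N.

Lemma lower_wact a d h d' h' u : d' = wdeg a + d -> h' = (wheight a + h)%N ->
  wspan (lower d h) v u -> wspan (lower d' h') v (wact a u).
Proof.
move=> -> ->; apply: wspan_wact => w [dw hw].
by split; rewrite !wordE ?dw ?ltn_add2l.
Qed.

(** The norms of the oscillators: [L_0] for [L] and [G], the level for [H] and
    [F].  The central charge [c_1] only enters with smaller height. *)
Lemma gbr_dual i : deg i < 0 -> exists c c' : K,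
  c != 0 /\ forall f : scgen -> S, gbr f (dual i) i =
    if height i == 1%N then c *: f (genL 0) + c' *: f genC1 else c *: f genC3.
Proof.
case: i => //= m m0.
- exists (- m - m)%:~R; eexists; split; first by rewrite intr_eq0; lia.
  move=> f; rewrite addNr; have -> : (m == 0) = false by lia.
  by [].
- exists (- m)%:~R, 0; split; first by rewrite intr_eq0; lia.
  by move=> f; rewrite addNr eqxx mul1r.
- exists 2; eexists; split; first by rewrite pnatr_eq0.
  by move=> f; rewrite (_ : _ + 1 = 0) //; lia.
- exists 1, 0; split; first exact: oner_neq0.
  by move=> f; rewrite (_ : _ + 1 = 0) // ; lia.
Qed.

(** A letter moves freely past letters other than its dual, up to smaller
    height. *)
Lemma lower_move i b c d h : (forall j, j \in b -> j <> dual i) ->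
  d = deg i + wdeg b + wdeg c -> h = (height i + wheight b + wheight c)%N ->
  wspan (lower d h) v (wact (i :: b ++ c) v
    - (-1) ^+ (scparity i && odd (count scparity b)) *: wact (b ++ i :: c) v).
Proof.
move=> bi -> ->; apply: (@move_letter _ _ _ [::]) => [|b1 j b2 k e dk hk hk'].
  exact: wspan_lin.
have {}hk' : (height k < height i + height j)%N.
  by apply/hk'/bi; rewrite e mem_cat mem_head orbT.
by apply: wspan_word; split; rewrite e !wordE ?dk; lia.
Qed.

(** Modulo smaller height the raising letter [dual i] acts as the derivative in
    [i]: only the copies of [i] in [m] contribute, each removing itself.  Even
    letters contribute without signs, so that the contributions of equal
    letters add up to a multiplicity instead of cancelling; an odd letter
    occurs at most once. *)
Lemma gact_dual_monomial i m n d h : deg i < 0 -> monomial m ->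
  d = wdeg m - deg i -> h = (height i + wheight m + n.*2)%N ->
  exists2 r : K, (r != 0) = (i \in m) &
    wspan (lower d h) v (gact (dual i) (wact (m ++ nseq n (genL 0)) v)
       - r *: wact (rem i m ++ nseq (n + height i) (genL 0)) v).
Proof.
move=> ineg mm -> ->; have [c [c' [c0 gbrE]]] := gbr_dual ineg.
(* The leading coefficient contributed by one copy of [i]. *)
pose c1 := if height i == 1%N then c else c * l.
have c10 : c1 != 0 by rewrite /c1; case: ifP => // _; rewrite mulf_neq0.
have hi1 : (height i <= 1)%N.
  by case: (i) ineg => //= p p0; case: eqVneq => // e; lia.
(* The multiplicity is made explicit for the induction to add up. *)
suff: exists s : bool, (scparity i \/ s = false) /\
    wspan (lower (wdeg m - deg i) (height i + wheight m + n.*2)) v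
      (gact (dual i) (wact (m ++ nseq n (genL 0)) v)
       - ((-1) ^+ s * c1 * (count_mem i m)%:R)
         *: wact (rem i m ++ nseq (n + height i) (genL 0)) v).
  case=> s [_ hs]; eexists; last exact: hs.
  by rewrite !mulf_eq0 !negb_or signr_eq0 c10 pnatr_eq0 -lt0n -has_count has_pred1.
elim: m mm => [|j m IH] mm.
  exists false; split; first by right.
  rewrite mulr0 scale0r subr0.
  set T := nseq n _.
  have := @lower_move (dual i) T [::] _ _ _ erefl erefl.
  rewrite cats0 !wact_cat /= kv ?scpositiveE ?deg_dual ?oppr_gt0 // wact0 scaler0 subr0.
  rewrite dualK !wordE !addr0 add0r !addn0 height_dual; apply.
  by move=> k /nseqP[-> _] e; move: ineg; rewrite -e.
have [jneg mm'] := monomial_cons mm.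
have [s [si hs]] := IH mm'.
set Q := wspan _ _.
have Ql : lin_closed Q by apply: wspan_lin.
pose T := nseq n (genL 0).
have {}hs : Q (gact j (gact (dual i) (wact (m ++ T) v))
     - ((-1) ^+ s * c1 * (count_mem i m)%:R)
         *: wact (j :: rem i m ++ nseq (n + height i) (genL 0)) v).
  have : Q (wact [:: j] (gact (dual i) (wact (m ++ T) v)
     - ((-1) ^+ s * c1 * (count_mem i m)%:R)
         *: wact (rem i m ++ nseq (n + height i) (genL 0)) v)).
    by apply: lower_wact hs; rewrite !wordE; lia.
  by rewrite wactB wactZ.
rewrite /= -/T gact_swap parity_dual; set x := gact (dual i) _ in hs *.
set g := gbr _ _ _.
have [eji|nji] := eqVneq j i; last first.
  have Qg : Q g.
    apply: lin_gbr => // k dk hk hk'.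
    have {}hk' : (height k < height (dual i) + height j)%N.
      by apply: hk' => e; move: nji; rewrite e dualK eqxx.
    apply: (@wspan_word _ _ _ _ (k :: m ++ T)); split.
      by rewrite !wordE dk deg_dual; lia.
    by move: hk'; rewrite !wordE height_dual; lia.
  exists ((scparity i && scparity j) (+) s); split.
    by case: si => [->|->]; [left|case: (scparity i); [left|right]].
  rewrite addrAC; apply: linD => //.
  rewrite signr_addb -!mulrA -scalerA -scalerBr add0n; apply: linZ => //.
  by rewrite mulrA.
subst j; rewrite /=.
have gE : Q (g - c1 *: wact (m ++ nseq (n + height i) (genL 0)) v).
  rewrite /g gbrE /c1; case: ifP => [/eqP hi|hi].
    rewrite hi addn1 addrAC -scalerBr; apply: linD => //; apply: linZ => //.
      rewrite -[X in Q (_ - X)]scale1r -[1](expr0 (-1)).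
      apply: (@lower_move (genL 0) m T); rewrite ?wordE ?hi /=; try lia.
      by move=> k km e; case: mm' => /(_ k km); rewrite e.
    apply: (@wspan_word _ _ _ _ (genC1 :: m ++ T)).
    by split; rewrite !wordE /= ?hi; lia.
  have -> : height i = 0%N by lia.
  by rewrite addn0 level scalerA subrr; apply: lin0.
exists false; split; first by right.
rewrite expr0 mul1r natrD mulrDr mulr1 scalerDl opprD [_ + g]addrC addrACA.
apply: linD => //.
have [im|im] := boolP (i \in m); last first.
  move: hs; rewrite (count_memPn im) !mulr0 !scale0r !subr0.
  exact: linZ.
have iev : scparity i = false.
  apply/negP => ip; case: mm => _ _ /(_ i ip).
  by rewrite /= eqxx ltnS leqn0 -[_ == _]negbK -lt0n -has_count has_pred1 im.
case: si => [|si]; first by rewrite iev.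
move: hs; rewrite si expr0 mul1r -cat_cons monomial_head // iev.
by rewrite scale1r.
Qed.

Definition adjoint (m : seq scgen) := rev (map dual m).

Lemma wdeg_adjoint m : wdeg (adjoint m) = - wdeg m.
Proof.
elim: m => [|i m IH]; first by rewrite wdeg_nil.
by rewrite /adjoint /= rev_cons -cats1 !wordE IH deg_dual; lia.
Qed.

Lemma wheight_adjoint m : wheight (adjoint m) = wheight m.
Proof.
elim: m => [|i m IH]; first by rewrite wheight_nil.
by rewrite /adjoint /= rev_cons -cats1 !wordE IH height_dual; lia.
Qed.

Lemma wact_adjoint_cons i m u :
  wact (adjoint (i :: m)) u = wact (adjoint m) (gact (dual i) u).
Proof. by rewrite /adjoint /= rev_cons -cats1 wact_cat. Qed.

(** Applying the letters of [adjoint m0] removes one by one the letters of [m0]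
    from [m]; degrees being equal, nothing is left exactly when [m = m0]. *)
Lemma monomial_pairing m0 m n : monomial m0 -> monomial m -> wdeg m = wdeg m0 ->
  exists2 r : K, (r != 0) = (m == m0) &
    wspan (lower 0 (wheight m0 + wheight m + n.*2)) v
      (wact (adjoint m0) (wact (m ++ nseq n (genL 0)) v)
       - r *: wact (nseq (n + wheight m0) (genL 0)) v).
Proof.
elim: m0 m n => [|i m0 IH] m n mm0 mm.
  rewrite wdeg_nil => m_deg; have -> : m = [::].
    case: m mm m_deg => // j m mm; have [jn [mn _ _]] := monomial_cons mm.
    have mle : wdeg m <= 0.
      by rewrite /wdeg big_seq; apply: sumr_le0 => k /mn/ltW.
    by rewrite wdeg_cons; lia.
  exists 1; first by rewrite oner_eq0.
  by rewrite wheight_nil !addn0 scale1r subrr; apply: wspan0.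
rewrite wdeg_cons => m_deg; have [ineg mm0'] := monomial_cons mm0.
have [r rE hr] := @gact_dual_monomial i m n _ _ ineg mm erefl erefl.
set Q := wspan _ _; have Ql : lin_closed Q by apply: wspan_lin.
have {}hr : Q (wact (adjoint m0) (gact (dual i) (wact (m ++ nseq n (genL 0)) v))
    - r *: wact (adjoint m0) (wact (rem i m ++ nseq (n + height i) (genL 0)) v)).
  rewrite -wactZ -wactB; apply: lower_wact hr.
    by rewrite wdeg_adjoint m_deg; lia.
  by rewrite wheight_adjoint wheight_cons; lia.
rewrite wact_adjoint_cons.
have [im|im] := boolP (i \in m); last first.
  exists 0; last first.
    have r0 : r = 0 by apply/eqP; move: rE; rewrite (negPf im) => /negbFE.
    by move: hr; rewrite r0 !scale0r.
  by rewrite eqxx; apply/esym/negbTE; apply: contra im => /eqP ->; apply: mem_head.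
have [|r' r'E hr'] := IH (rem i m) (n + height i)%N mm0' (monomial_rem i mm).
  by have := wdeg_rem im; lia.
exists (r * r').
  rewrite mulf_eq0 negb_or rE im r'E /=; apply/eqP/eqP => [e|->]; last by rewrite /= eqxx.
  by apply: monomial_perm_eq => //; rewrite -e perm_to_rem.
have {}hr' : Q (wact (adjoint m0) (wact (rem i m ++ nseq (n + height i) (genL 0)) v)
   - r' *: wact (nseq (n + height i + wheight m0) (genL 0)) v).
  apply: wspan_sub hr' => w [dw hw]; split=> //; apply: (leq_trans hw).
  by rewrite wheight_cons (wheight_rem im); lia.
have := linD Ql hr (linZ Ql r hr').
by rewrite scalerBr addrA subrK scalerA wheight_cons addnA.
Qed.

Definition L0_lower n w := exists2 m, w = nseq m (genL 0) & (m < n)%N.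

Hypothesis L0_free : forall n,
  ~ wspan (L0_lower n) v (wact (nseq n (genL 0)) v).

Definition pbw_vec (p : seq scgen * nat) := wact (p.1 ++ nseq p.2 (genL 0)) v.

(** Pairing a vanishing combination with the adjoint of a monomial of lowest
    degree, and of greatest height among those, isolates one power of [L_0]:
    the terms of higher degree are sent above [v], hence to zero, and the others
    are orthogonal or of smaller height. *)
Lemma pbw_independent (s : seq (seq scgen * nat)) (a : seq scgen * nat -> K) :
  uniq s -> (forall p, p \in s -> monomial p.1) ->
  \sum_(p <- s) a p *: pbw_vec p = 0 -> forall p, p \in s -> a p = 0.
Proof.
move=> us sm s0 q qs; apply/eqP; apply: contraT => aq.
pose s' := [seq p <- s | a p != 0].
have qs' : q \in s' by rewrite mem_filter aq.
have [p1 p1s p1m] := exists_max (fun p => `|wdeg p.1|%N) qs'.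
pose s'' := [seq p <- s' | wdeg p.1 == wdeg p1.1].
have p1s'' : p1 \in s'' by rewrite mem_filter eqxx.
have [p0 p0s p0m] := exists_max (fun p => wheight p.1 + p.2.*2)%N p1s''.
have {p1s''} [/eqP p01 p0s' ] : wdeg p0.1 == wdeg p1.1 /\ p0 \in s'.
  by move: p0s; rewrite mem_filter => /andP.
have [ap0 p0s0] : a p0 != 0 /\ p0 \in s by move: p0s'; rewrite mem_filter => /andP.
have wneg p : p \in s -> wdeg p.1 <= 0.
  by move=> /sm[h _ _]; rewrite /wdeg big_seq; apply: sumr_le0 => k /h/ltW.
pose N := (p0.2 + wheight p0.1)%N.
have Ql := wspan_lin (L0_lower N) v.
set Q := wspan _ _ in Ql.
have lowQ h u : (h <= N.*2)%N -> wspan (lower 0 h) v u -> Q u.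
  move=> hN; apply: wspan_ind_lin => // w [dw hw].
  have [_ /(_ dw)] := word_evaluates w; apply: wspan_sub => x [n -> hn].
  by exists n => //; move: hn hw hN; clear; lia.
have [r rE hr] := @monomial_pairing p0.1 p0.1 p0.2 (sm _ p0s0) (sm _ p0s0) erefl.
rewrite eqxx in rE.
have Qp0 : Q (wact (adjoint p0.1) (pbw_vec p0) - r *: wact (nseq N (genL 0)) v).
  by apply: lowQ hr; rewrite /N; clear; lia.
have Qp p : p \in s -> p != p0 -> Q (a p *: wact (adjoint p0.1) (pbw_vec p)).
  move=> ps pp0; have [->|ap] := eqVneq (a p) 0; first by rewrite scale0r; apply: lin0.
  apply: linZ => //.
  have ps' : p \in s' by rewrite mem_filter ap.
  have := p1m p ps'; have := wneg _ ps; have := wneg _ p0s0.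
  rewrite leq_eqVlt => wp0 wp /orP[/eqP wpp1|wpp1]; last first.
    have [zero _] := word_evaluates (adjoint p0.1 ++ p.1 ++ nseq p.2 (genL 0)).
    rewrite /pbw_vec -wact_cat zero.
      exact: (lin0 Ql).
    by rewrite !wordE wdeg_adjoint; move: wp0 wp wpp1 p01; clear; lia.
  have wpp0 : wdeg p.1 = wdeg p0.1 by move: wp0 wp wpp1 p01; clear; lia.
  have hp : (wheight p.1 + p.2.*2 <= wheight p0.1 + p0.2.*2)%N.
    by apply: p0m; rewrite mem_filter ps' wpp0 p01 eqxx.
  have [r' r'E hr'] := @monomial_pairing p0.1 p.1 p.2 (sm _ p0s0) (sm _ ps) wpp0.
  have {}hr' := lowQ _ _ _ hr'.
  rewrite -[X in Q X](subrK (r' *: wact (nseq (p.2 + wheight p0.1) (genL 0)) v)).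
  apply: linD => //; first by apply: hr'; move: hp; rewrite /N; clear; lia.
  have [e|ne] := eqVneq p.1 p0.1; last first.
    by rewrite (negPf ne) in r'E; rewrite (eqP (negbFE r'E)) scale0r; apply: lin0.
  apply: linZ => //; apply: wspan_word; exists (p.2 + wheight p0.1)%N => //.
  have : p.2 <> p0.2 by move=> e2; case/eqP: pp0; apply: injective_projections.
  by move: hp; rewrite e /N; clear; lia.
case: (L0_free (n := N)).
have := congr1 (wact (adjoint p0.1)) s0; rewrite wact0.
rewrite (_ : wact _ _ = \sum_(p <- s) a p *: wact (adjoint p0.1) (pbw_vec p)); last first.
  elim: (s) => [|p x IH]; first by rewrite !big_nil wact0.
  by rewrite !big_cons wactP IH.
rewrite (bigD1_seq p0) //= => /eqP; rewrite addr_eq0 => /eqP s0'.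
have Qr : Q (\sum_(p <- s | p != p0) a p *: wact (adjoint p0.1) (pbw_vec p)).
  rewrite big_seq_cond; apply: (big_ind Q) => [|x y|p /andP[]];
    [exact: lin0|exact: linD|exact: Qp].
have : Q (a p0 *: (r *: wact (nseq N (genL 0)) v)).
  have := linB Ql (linN Ql Qr) (linZ Ql (a p0) Qp0).
  by rewrite -s0' scalerBr opprB addrC subrK.
rewrite scalerA => /(linZ Ql (a p0 * r)^-1).
by rewrite scalerA mulVf ?scale1r // mulf_neq0 // rE.
Qed.
End Independence.

(** * Eigenvectors in countable dimension *)

(** Uncountability, in the form in which it is used: a map to the natural
    numbers has an infinite fiber. *)
Definition large_fibers (T : eqType) := forall n : T -> nat,
  exists k, forall N, exists s : seq T,
    [/\ uniq s, size s = N & forall x, x \in s -> n x = k].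

Section Eigen.
Variables (K : numClosedFieldType) (V : lmodType K) (f : V -> V).
Hypothesis fP : forall a u v, f (a *: u + v) = a *: f u + f v.
Implicit Types (p q : {poly K}) (u v : V).

Definition pact p u := \sum_(i < size p) p`_i *: iter i f u.

Lemma fun_linD u v : f (u + v) = f u + f v.
Proof. by have := fP 1 u v; rewrite !scale1r. Qed.

Lemma fun_lin0 : f 0 = 0.
Proof. by apply: (@addrI _ (f 0)); rewrite -fun_linD !addr0. Qed.

Lemma fun_linZ a u : f (a *: u) = a *: f u.
Proof. by rewrite -[a *: u]addr0 fP fun_lin0 addr0. Qed.

Lemma pact_widen n p u : (size p <= n)%N ->
  pact p u = \sum_(i < n) p`_i *: iter i f u.
Proof.
move=> pn; rewrite /pact (big_ord_widen n (fun i => p`_i *: iter i f u) pn).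
rewrite [RHS](bigID (fun i : 'I_n => (i < size p)%N)) /= [X in _ + X]big1 ?addr0 //.
by move=> i; rewrite -leqNgt => /(nth_default 0) ->; rewrite scale0r.
Qed.

Lemma pactP a p q u : pact (a *: p + q) u = a *: pact p u + pact q u.
Proof.
pose n := maxn (size (a *: p + q)) (maxn (size p) (size q)).
rewrite !(@pact_widen n) ?leq_max ?leqnn ?orbT //.
rewrite scaler_sumr -big_split /=; apply: eq_bigr => i _.
by rewrite coefD coefZ scalerDl scalerA.
Qed.

Lemma pact0 u : pact 0 u = 0.
Proof. by rewrite /pact size_poly0 big_ord0. Qed.

Lemma pact1 u : pact 1 u = u.
Proof. by rewrite /pact size_poly1 big_ord1 coef1 scale1r. Qed.

Lemma pactZ a p u : pact (a *: p) u = a *: pact p u.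
Proof. by rewrite -[a *: p]addr0 pactP pact0 addr0. Qed.

Lemma pactMX p u : pact (p * 'X) u = f (pact p u).
Proof.
have [->|p0] := eqVneq p 0; first by rewrite mul0r !pact0 fun_lin0.
rewrite /pact size_mulX // big_ord_recl coefMX eqxx scale0r add0r.
elim: (size p) => [|n IH]; first by rewrite !big_ord0 fun_lin0.
by rewrite !big_ord_recr fun_linD -IH fun_linZ coefMX.
Qed.

Lemma pact_lin p a u v : pact p (a *: u + v) = a *: pact p u + pact p v.
Proof.
rewrite /pact scaler_sumr -big_split /=; apply: eq_bigr => i _.
have -> : iter i f (a *: u + v) = a *: iter i f u + iter i f v.
  by elim: (i : nat) => //= n ->; rewrite fP.
by rewrite scalerDr !scalerA mulrC.
Qed.

Lemma pact_comm p u : pact p (f u) = f (pact p u).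
Proof.
rewrite /pact; elim: (size p) => [|n IH]; first by rewrite !big_ord0 fun_lin0.
by rewrite !big_ord_recr fun_linD -IH fun_linZ /= -iterS iterSr.
Qed.

Lemma pact0r p : pact p 0 = 0.
Proof. by have := pact_lin p (-1) 0 0; rewrite scaler0 addr0 scaleN1r addNr. Qed.

Lemma pactZr p a u : pact p (a *: u) = a *: pact p u.
Proof. by rewrite -[a *: u]addr0 pact_lin pact0r addr0. Qed.

Lemma pact_suml n (P : 'I_n -> {poly K}) u :
  pact (\sum_i P i) u = \sum_i pact (P i) u.
Proof.
apply: (big_morph (pact^~ u)) => [p q|]; last exact: pact0.
by have := pactP 1 p q u; rewrite !scale1r.
Qed.

Lemma pact_sumr n p (w : 'I_n -> V) :
  pact p (\sum_i w i) = \sum_i pact p (w i).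
Proof.
apply: (big_morph (pact p)) => [u v|].
  by have := pact_lin p 1 u v; rewrite !scale1r.
exact: pact0r.
Qed.

Lemma pact_factor a p u :
  pact (p * ('X - a%:P)) u = f (pact p u) - a *: pact p u.
Proof.
have -> : p * ('X - a%:P) = (- a) *: p + p * 'X.
  by rewrite mulrBr addrC -mulrN mulrC -polyCN mul_polyC.
by rewrite pactP pactMX scaleNr addrC.
Qed.

Lemma pact_factorr a p u :
  pact (p * ('X - a%:P)) u = pact p (f u - a *: u).
Proof.
have -> : f u - a *: u = (- a) *: u + f u by rewrite addrC scaleNr.
by rewrite pact_factor pact_lin pact_comm scaleNr addrC.
Qed.

(** Peeling off the linear factors of [p] one at a time, the last nonzero vector
    met is an eigenvector. *)
Lemma pact_eigen (Q : V -> Prop) p u : lin_closed Q ->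
  (forall v, Q v -> Q (f v)) -> Q u -> u <> 0 -> p != 0 -> pact p u = 0 ->
  exists v a, [/\ Q v, v <> 0 & f v = a *: v].
Proof.
move=> Ql Qf Qu u0; have [r ->] := closed_field_poly_normal p.
rewrite scale_poly_eq0 negb_or pactZ => /andP[l0 _] /eqP.
rewrite scaler_eq0 (negPf l0) /= => /eqP.
have Qp q v : Q v -> Q (pact q v).
  move=> Qv; rewrite /pact; apply: (big_ind Q) => [|x y|i _].
  - exact: lin0. - exact: linD.
  apply: linZ => //; elim: (i : nat) => //= n; exact: Qf.
elim: r => [|a r IH]; first by rewrite big_nil pact1.
rewrite big_cons mulrC pact_factor => e.
have [/IH//|n0] := eqVneq (pact (\prod_(z <- r) ('X - z%:P)) u) 0.
exists (pact (\prod_(z <- r) ('X - z%:P)) u), a; split; [exact: Qp|exact/eqP|].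
exact: subr0_eq.
Qed.

(** A space of countable dimension has no room for the vectors
    [(f - a)^-1 u], for [a] in an uncountable field, to be independent; clearing
    denominators in a relation among them gives a polynomial in [f] that
    kills [u]. *)
Lemma dixmier_eigenvector (e : nat -> V) :
  large_fibers K ->
  (forall u, exists n (c : nat -> K), u = \sum_(i < n) c i *: e i) ->
  (exists u : V, u <> 0) ->
  (forall a u, exists v, u = f v - a *: v) ->
  exists v a, v <> 0 /\ f v = a *: v.
Proof.
move=> fib span_e [u u0] surj.
have [g gE] := choice (fun a => surj a u).
have [n nE] := choice (fun a => span_e (g a)).
have {nE}[c cE] := choice nE.
have [k /(_ k.+1)[s [us ss sk]]] := fib n.
pose t (i : 'I_k.+1) := s`_i.
pose M := \matrix_(i < k.+1, j < k) c (t i) j.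
have : kermx M != 0.
  rewrite kermx_eq0 /row_free neq_ltn; apply/orP; left.
  by rewrite ltnS; apply: rank_leq_col.
case/rowV0Pn => y /sub_kermxP yM y0.
have gy : \sum_i y 0 i *: g (t i) = 0.
  transitivity (\sum_i \sum_(j < k) (y 0 i * M i j) *: e j).
    apply: eq_bigr => i _; rewrite cE sk ?mem_nth ?ss // scaler_sumr.
    by apply: eq_bigr => j _; rewrite mxE scalerA.
  rewrite exchange_big big1 // => j _; rewrite -scaler_suml.
  have /rowP/(_ j) := yM; rewrite !mxE => ->; exact: scale0r.
(* Multiply the relation [gy] by the product of all the [f - t j]. *)
pose P i := \prod_(j < k.+1 | j != i) ('X - (t j)%:P).
pose p := \sum_i y 0 i *: P i.
have pu : pact p u = 0.
  transitivity (pact (\prod_j ('X - (t j)%:P)) (\sum_i y 0 i *: g (t i))).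
    rewrite pact_suml pact_sumr; apply: eq_bigr => i _.
    by rewrite pactZ pactZr (bigD1 i) //= mulrC pact_factorr -gE.
  by rewrite gy pact0r.
have [i yi] : exists i, y 0 i != 0.
  by apply/existsP; apply: contraR y0 => /existsPn h; apply/eqP/rowP => i;
    rewrite mxE; apply/eqP; have := h i; rewrite negbK.
(* At the node [t i], only the [i]-th term of [p] survives. *)
have p0 : p != 0.
  apply: contra yi => /eqP/(congr1 (horner^~ (t i))).
  rewrite horner_sum horner0 (bigD1 i) //= big1 => [|j ji]; last first.
    by rewrite hornerZ horner_prod (bigD1 i) 1?eq_sym //= hornerXsubC subrr mul0r mulr0.
  rewrite addr0 hornerZ horner_prod => /eqP; rewrite mulf_eq0 => /orP[//|].
  rewrite prodf_seq_eq0 => /hasP[j _ /andP[ji]]; rewrite hornerXsubC subr_eq0.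
  by rewrite nth_uniq ?ss // => /eqP/val_inj/eqP; rewrite eq_sym (negPf ji).
have [v [a [_ v0 fv]]] := @pact_eigen (fun _ => True) p u
  (conj I (fun _ _ _ _ _ => I)) (fun _ _ => I) I u0 p0 pu.
by exists v, a.
Qed.
End Eigen.

(** Otherwise the line would be a countable union of finite sets, hence of
    measure zero. *)
Lemma real_large_fibers (R : realType) : large_fibers R.
Proof.
move=> n.
have [k hk] : exists k, infinite_set [set x | n x = k].
  apply/not_existsP => fin.
  have ct : countable (@setT R).
    rewrite (_ : setT = (\bigcup_k [set x | n x = k])%classic); last first.
      by apply/seteqP; split=> // x _; exists (n x).
    apply: bigcup_countable => // k _; apply: finite_set_countable.
    exact: contrapT (fin k).
  have := countable_lebesgue_measure0
    (sub_countable (subset_card_le (@subsetT _ `[0, 1]%classic)) ct).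
  rewrite lebesgue_measure_itv /= lte_fin ltr01 oppr0 adde0.
  by move/eqP; rewrite eqe oner_eq0.
exists k => N; have [B Bk BN] := infinite_set_fset N hk.
exists (take N (finmap.enum_fset B)); split.
- by rewrite take_uniq ?finmap.fset_uniq.
- by rewrite size_take_min; apply/minn_idPl.
- by move=> x /mem_take xB; apply: Bk.
Qed.

(** * Schur's lemma *)

Section Graded.
Variables (K : numFieldType) (S : lieModType (scalg K)).
Implicit Types (u v : S).

Lemma homog_lin b : lin_closed (homog b : S -> Prop).
Proof. by split=> [|r u v]; [apply: homog0 | apply: homogP]. Qed.

Lemma homog_sum0 u v : homog false u -> homog true v -> u + v = 0 -> u = 0 /\ v = 0.
Proof.
move=> u0 v1 /eqP; rewrite addr_eq0 => /eqP uv.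
have vz : v = 0.
  apply: homog_trivI => //; rewrite -[v]opprK -uv.
  by apply: linN => //; apply: homog_lin.
by rewrite uv vz oppr0.
Qed.

Lemma act0r (x : scalg K) : act x (0 : S) = 0.
Proof. by have := actPr (-1) x (0 : S) 0; rewrite scaler0 addr0 scaleN1r addNr. Qed.

Lemma actZ (x : scalg K) r u : act x (r *: u) = r *: act x u.
Proof. by rewrite -[r *: u]addr0 actPr act0r addr0. Qed.

Lemma actB (x : scalg K) u v : act x (u - v) = act x u - act x v.
Proof. by rewrite addrC -scaleN1r actPr scaleN1r addrC. Qed.

Lemma lin_act (Q : S -> Prop) (x : scalg K) u : lin_closed Q ->
  (forall i, Q (gact i u)) -> Q (act x u).
Proof.
move=> Ql Qi; elim/scalg_ind: x => [|r x y Qx Qy|i]; last exact: Qi.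
  by rewrite act0l; apply: lin0.
by rewrite actPl; apply: linP.
Qed.

Lemma wact_homog w b v : homog b v -> exists c, homog c (wact w v).
Proof.
move=> vb; elim: w => [|i w [c hc]]; first by exists b.
by exists (scparity i (+) c); apply: gact_homog.
Qed.

Lemma wspan_split P b v u : homog b v -> wspan P v u ->
  exists u0 u1, [/\ wspan P v u0, wspan P v u1, homog false u0, homog true u1
    & u = u0 + u1].
Proof.
move=> vb; elim=> [|r w x Pw _ [x0 [x1 [s0 s1 h0 h1 ->]]]].
  by exists 0, 0; rewrite addr0; split=> //; by [apply: wspan0|apply: homog0].
have [[] hw] := wact_homog w vb.
  exists x0, (r *: wact w v + x1); split=> //; first exact: wspanS.
    exact: homogP.
  by rewrite addrCA.
exists (r *: wact w v + x0), x1; split=> //; first exact: wspanS.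
  exact: homogP.
by rewrite addrA.
Qed.

Lemma wspan_submodule b v : homog b v -> submodule (wspan (fun _ => True) v).
Proof.
move=> vb; have Ql := wspan_lin (fun _ => True) v; split.
- exact: wspan0.
- by case: Ql.
- move=> v0 v1 h0 h1 /(wspan_split vb)[u0 [u1 [s0 s1 k0 k1 e]]].
  have [|||e0 e1] := @homog_sum0 (v0 - u0) (v1 - u1).
  - by apply: (linB (homog_lin false)).
  - by apply: (linB (homog_lin true)).
  - by rewrite addrACA -opprD e subrr.
  by rewrite (subr0_eq e0) (subr0_eq e1).
- by move=> x u su; apply: lin_act => // i; apply: (wspan_wact (a := [:: i])) su.
Qed.

Lemma killed_split u0 u1 : homog false u0 -> homog true u1 ->
  killed 0 (u0 + u1) -> killed 0 u0 /\ killed 0 u1.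
Proof.
move=> h0 h1 k.
suff e i : scpositive i -> gact i u0 = 0 /\ gact i u1 = 0.
  by split=> i ip _; have [] := e i ip.
move=> ip; have := k i ip (leq0n _); rewrite gactD.
have := gact_homog i h0; have := gact_homog i h1.
case: (scparity i) => /= g1 g0; last exact: homog_sum0.
by rewrite addrC => /(homog_sum0 g1 g0)[].
Qed.

Lemma killed_lin : lin_closed (killed 0 : S -> Prop).
Proof.
split=> [|r x y kx ky] i ip i0; first exact: gact0.
by rewrite gactP kx // ky // scaler0 addr0.
Qed.

Lemma killed_L0 u : killed 0 u -> killed 0 (gact (genL 0) u).
Proof.
move=> ku i ip _; rewrite gact_swap ku // gact0 scaler0 add0r.
apply: (lin_gbr (Q := fun y => y = 0)) => [|k dk _ _].
  by split=> // r x y -> ->; rewrite scaler0 addr0.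
by apply: ku => //; rewrite scpositiveE dk addr0 -scpositiveE.
Qed.

End Graded.

Lemma gbr_central (K : numFieldType) (V : lmodType K) (f : scgen -> V) i j :
  central i -> gbr f i j = 0.
Proof.
case: i => [m|m|m|m|||] [] //= i0 iL; try by lia.
- by case: iL; congr genL; lia.
- have -> : m = 0 by lia.
  case: j => [n|n|n|n|||] //=; rewrite ?scale0r ?mulr0 ?scale0r //.
  case: eqVneq => [|_]; last by rewrite mul0r scale0r subrr.
  by rewrite addr0 => ->; rewrite expr0n addr0 mulr0 scale0r subrr.
Qed.

Lemma central_parity i : central i -> scparity i = false.
Proof. by case: i => // k [] /=; lia. Qed.

Section Simple.
Variables (K : numClosedFieldType) (S : lieModType (scalg K)).
Implicit Types (u v : S).
Hypothesis Ssimple : simple_module S.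
Hypothesis uncountable : large_fibers K.

Lemma simple_all (W : S -> Prop) v : submodule W -> W v -> v <> 0 ->
  forall u, W u.
Proof. by move=> sW Wv v0; case: Ssimple => _ /(_ W sW)[/(_ v Wv)|]. Qed.

(** The positive letters being homogeneous, they kill the components of a
    vector that they kill. *)
Lemma exists_homog_killed : (exists v, v <> 0 /\ killed 0 v) ->
  exists b v, [/\ homog b v, v <> 0 & killed 0 v].
Proof.
move=> [v [v0 kv]]; have [x0 [x1 [h0 h1 vE]]] := homog_split v.
have [k0 k1] : killed 0 x0 /\ killed 0 x1 by apply: killed_split; rewrite -?vE.
have [x0z|/eqP x0n] := eqVneq x0 0; last by exists false, x0.
exists true, x1; split=> // x1z; apply: v0.
by rewrite vE x0z x1z addr0.
Qed.

Lemma simple_countable b v : homog b v -> v <> 0 ->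
  exists e : nat -> S, forall u, exists n (c : nat -> K),
    u = \sum_(i < n) c i *: e i.
Proof.
move=> vb v0.
have [e eE] : exists e : nat -> S, forall w, e (choice.pickle w) = wact w v.
  exists (fun n => oapp (fun w : seq scgen => wact w v) 0 (choice.unpickle n)) => w.
  by rewrite choice.pickleK.
exists e => u.
have := simple_all (wspan_submodule vb) (wspan_word (w := [::]) v I) v0 u.
elim=> [|r w x _ _ [n [c ->]]]; first by exists 0%N, (fun _ => 0); rewrite big_ord0.
pose N := maxn n (choice.pickle w).+1.
exists N, (fun i => r * (i == choice.pickle w)%:R + (if (i < n)%N then c i else 0)).
under [RHS]eq_bigr do rewrite scalerDl.
rewrite big_split /=; congr (_ + _).
  have wN : (choice.pickle w < N)%N by rewrite leq_max leqnn orbT.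
  rewrite (bigD1 (Ordinal wN)) //= eE eqxx mulr1 big1 ?addr0 // => i.
  by rewrite -val_eqE /= => /negPf ->; rewrite mulr0 scale0r.
rewrite (big_ord_widen N (fun i => c i *: e i)) ?leq_maxl // big_mkcond /=.
by apply: eq_bigr => i _; case: ifP; rewrite ?scale0r.
Qed.

Lemma central_act i (x : scalg K) u : central i ->
  gact i (act x u) = act x (gact i u).
Proof.
move=> ci; elim/scalg_ind: x => [|r x y hx hy|j].
- by rewrite !act0l gact0.
- by rewrite !actPl gactP hx hy.
- by rewrite -/(gact j _) gact_swap gbr_central // central_parity // scale1r addr0.
Qed.

Lemma central_homog i b u : central i -> homog b u -> homog b (gact i u).
Proof. by move=> /central_parity ip /(gact_homog i); rewrite ip. Qed.

(** Kernels and images of [i - a] are submodules.  If [i] is not the scalar [a],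
    then [i - a] is surjective; if this holds for all [a], some [i - a] has
    nevertheless a kernel, which is all of [S]. *)
Lemma central_scalar i : central i -> exists a, forall u, gact i u = a *: u.
Proof.
move=> ci; have [//|nscal] := pselect (exists a, forall u, gact i u = a *: u).
have hT a b u : homog b u -> homog b (gact i u - a *: u).
  move=> hu; apply: (linB (homog_lin S b)); first exact: central_homog.
  exact: (linZ (homog_lin S b)).
have Tadd a u v : (gact i u - a *: u) + (gact i v - a *: v)
    = gact i (u + v) - a *: (u + v).
  by rewrite gactD scalerDr opprD addrACA.
have surj a u : exists v, u = gact i v - a *: v.
  case: Ssimple => _ /(_ (fun u => exists v, u = gact i v - a *: v)) [||]; last by [].
    split.
    - by exists 0; rewrite gact0 scaler0 subrr.
    - move=> r _ _ [x ->] [y ->]; exists (r *: x + y).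
      by rewrite gactP scalerBr scalerDr opprD addrACA !scalerA mulrC.
    - move=> v0 v1 h0 h1 [x]; have [x0 [x1 [k0 k1 ->]]] := homog_split x.
      rewrite -Tadd => e.
      have [|||e0 e1] := @homog_sum0 _ _
        (v0 - (gact i x0 - a *: x0)) (v1 - (gact i x1 - a *: x1)).
      - by apply: (linB (homog_lin S false)) => //; apply: hT.
      - by apply: (linB (homog_lin S true)) => //; apply: hT.
      - by rewrite addrACA -opprD e subrr.
      by split; [exists x0; apply: subr0_eq|exists x1; apply: subr0_eq].
    - move=> x _ [y ->]; exists (act x y).
      by rewrite actB actZ central_act.
  move=> z; case: nscal; exists a => w; apply: subr0_eq; apply: z; by exists w.
have [[v0 v0n] _] := Ssimple.
have [b [v [vb vn]]] : exists b v, homog b v /\ v <> 0.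
  have [x0 [x1 [h0 h1 vE]]] := homog_split v0.
  have [x0z|/eqP ?] := eqVneq x0 0; last by exists false, x0.
  by exists true, x1; split=> // x1z; apply: v0n; rewrite vE x0z x1z addr0.
have [e eE] := simple_countable vb vn.
have [x [a [xn xa]]] :=
  dixmier_eigenvector (gactP i) uncountable eE (ex_intro _ v0 v0n) surj.
exists a; apply: (@simple_all (fun u => gact i u = a *: u) x) => //; split.
- by rewrite gact0 scaler0.
- by move=> r y z hy hz; rewrite gactP hy hz scalerDr !scalerA mulrC.
- move=> y0 y1 h0 h1 e01.
  have [|||e0 e1] := @homog_sum0 _ _ (gact i y0 - a *: y0) (gact i y1 - a *: y1).
  - exact: hT.
  - exact: hT.
  - by rewrite Tadd e01 subrr.
  by rewrite (subr0_eq e0) (subr0_eq e1).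
- by move=> y z hz; rewrite central_act // hz actZ.
Qed.
End Simple.

(** * Highest weight vectors *)

Section HighestWeight.
Variables (K : numClosedFieldType) (S : lieModType (scalg K)).
Implicit Types (u v : S).
Hypothesis Ssimple : simple_module S.
Hypothesis scalar : forall i, central i -> exists a, forall u, gact i u = a *: u.
Variable l : K.
Hypothesis l_neq0 : l != 0.
Hypothesis level : forall u, gact genC3 u = l *: u.

Lemma pact_Xn n u : pact (gact (genL 0)) 'X^n u = wact (nseq n (genL 0)) u.
Proof.
elim: n => [|n IH]; first by rewrite expr0 pact1.
by rewrite exprSr (pactMX (gactP (genL 0))) IH.
Qed.

Lemma L0_span_pact n v u : wspan (L0_lower n) v u ->
  exists2 q : {poly K}, (size q <= n)%N & u = pact (gact (genL 0)) q v.
Proof.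
elim=> [|r w x [m -> mn] _ [q qn ->]].
  by exists 0; rewrite ?size_poly0 ?pact0.
exists (r *: 'X^m + q); last by rewrite pactP pact_Xn.
rewrite (leq_trans (size_polyD _ _)) // geq_max qn andbT.
by rewrite (leq_trans (size_scale_leq _ _)) // size_polyXn.
Qed.

Lemma L0_eigen b v n : homog b v -> v <> 0 -> killed 0 v ->
  wspan (L0_lower n) v (wact (nseq n (genL 0)) v) ->
  exists (x : S) a,
    [/\ homog b x /\ killed 0 x, x <> (0 : S) & gact (genL 0) x = a *: x].
Proof.
move=> vb vn kv /L0_span_pact[q qn e].
apply: (@pact_eigen _ S _ (gactP (genL 0)) (fun x => homog b x /\ killed 0 x)
  ('X^n - q) v) => //.
- split; first by split; [apply: homog0 | apply: lin0; apply: killed_lin].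
  move=> r x y [hx kx] [hy ky]; split; first exact: homogP.
  exact: (linP (killed_lin S)).
- by move=> x [hx kx]; split; [apply: (gact_homog (genL 0) hx) | apply: killed_L0].
- apply/eqP => /subr0_eq qX; move: qn; rewrite -qX size_polyXn ltnn //.
rewrite -[_ - q]addrC -scaleN1r pactP pact_Xn e scaleN1r addNr //.
Qed.

Lemma eigen_highest_weight b (x : S) a : homog b x -> killed 0 x -> x <> 0 ->
  gact (genL 0) x = a *: x -> highest_weight_module S.
Proof.
move=> hx kx xn xa.
have [|d hd] := @scalar (genH 0); first by split.
have [|c hc] := @scalar genC1; first by split.
have [|z hz] := @scalar genC2; first by split.
exists a, d, c, z, l, x; split; last first.
  by move=> W sW Wx; apply: (simple_all Ssimple sW Wx xn).
split.
- by split=> // y yp; apply: killed_gplus.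
- by exists b.
- by split=> //; [apply: hd|apply: hc|apply: hz|apply: level].
Qed.

(** The shift of the exponent is the point: [L_0 v] contributes one more factor
    [L_0], so that the monomial [v] itself does not occur. *)
Lemma pbw_span_sum v u : wspan pbw_word (gact (genL 0) v) u ->
  exists s (a : seq scgen * nat -> K),
    [/\ uniq s, forall p, p \in s -> monomial p.1 /\ (0 < p.2)%N
      & u = \sum_(p <- s) a p *: pbw_vec v p].
Proof.
elim=> [|r w x [m [n [mm ->]]] _ [s [a [us sm ->]]]].
  by exists [::], (fun _ => 0); split; rewrite ?big_nil.
have -> : wact (m ++ nseq n (genL 0)) (gact (genL 0) v) = pbw_vec v (m, n.+1).
  rewrite /pbw_vec /= !wact_cat; congr (wact m _).
  by elim: n => //= n ->.
set q := (m, n.+1).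
have [qs|qs] := boolP (q \in s).
  exists s, (fun p => r * (p == q)%:R + a p); split=> //.
  under [RHS]eq_bigr do rewrite scalerDl; rewrite big_split /=; congr (_ + _).
  rewrite (bigD1_seq q) //= eqxx mulr1 big1 ?addr0 // => p /negPf ->.
  by rewrite mulr0 scale0r.
exists (q :: s), (fun p => if p == q then r else a p); split.
- by rewrite /= qs.
- by move=> p; rewrite inE => /predU1P[->|/sm //].
rewrite big_cons eqxx; congr (_ + _); apply: eq_big_seq => p ps.
by case: eqVneq => // pq; rewrite -pq ps in qs.
Qed.

(** If the powers were independent, the submodule generated by [L_0 v] would
    be nonzero and not contain [v]. *)
Lemma L0_not_free b v : homog b v -> v <> 0 -> killed 0 v ->
  exists n, wspan (L0_lower n) v (wact (nseq n (genL 0)) v).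
Proof.
move=> hv vn kv; apply/not_existsP => L0f.
have w0 : gact (genL 0) v <> 0.
  by move=> e; apply: (L0f 1%N); rewrite /= e; apply: wspan0.
have v_eigen u i : central i -> exists a : K, gact i u = a *: u.
  by move=> /scalar[a ha]; exists a.
have hw : homog b (gact (genL 0) v) by apply: (gact_homog (genL 0) hv).
have : wspan pbw_word (gact (genL 0) v) v.
  have := simple_all Ssimple (wspan_submodule hw)
    (wspan_word (w := [::]) (gact (genL 0) v) I) w0 v.
  apply: wspan_ind_lin => [|w _]; first exact: wspan_lin.
  apply: pbw_span; [exact: killed_L0 | exact: v_eigen].
case/pbw_span_sum => s [a [us sm vE]].
pose o : seq scgen * nat := ([::], 0%N).
have os : o \notin s by apply/negP => /sm[].
have := @pbw_independent K S v kv (v_eigen v) l l_neq0 level L0f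
  (o :: s) (fun p => if p == o then -1 else a p).
rewrite /= os => /(_ us)/(_ _ _ o (mem_head _ _))/wrap[].
- by move=> p; rewrite inE => /predU1P[->|/sm[]].
- rewrite big_cons eqxx scaleN1r {1}/pbw_vec /=; apply/eqP.
  rewrite addrC subr_eq0 [X in _ == X]vE; apply/eqP/eq_big_seq => p ps.
  by case: eqVneq => // po; rewrite -po ps in os.
by rewrite eqxx => /eqP; rewrite oppr_eq0 oner_eq0.
Qed.

End HighestWeight.

Lemma gplus_scbas (K : numFieldType) i : scpositive i -> gplus (scbas K i).
Proof. by move=> ip j /(fsubsetP monalg.msuppU_le); rewrite inE => /eqP ->. Qed.

Theorem theorem6p1 (R : realType) (S : lieModType (scalg R[i]))
    (S_neq0 : nonzero_module S)
    (S_nil : forall x : scalg R[i], gplus x -> locally_nilpotent S x) :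
  (exists v : S, v <> 0 /\ forall x : scalg R[i], gplus x -> act x v = 0) /\
  (simple_module S ->
   forall l : R[i], l <> 0 -> has_level S l -> highest_weight_module S).
Proof.
have ex : exists v : S, v <> 0 /\ killed 0 v.
  by apply: exists_killed => // i ip; apply/S_nil/gplus_scbas.
split.
  have [v [vn kv]] := ex; exists v; split=> // x xp; exact: killed_gplus.
move=> Ssimple l /eqP l0 level.
have unc : large_fibers R[i].
  move=> n; have [k hk] := real_large_fibers (fun x => n x%:C%C).
  exists k => N; have [s [us ss sk]] := hk N.
  exists [seq x%:C%C | x <- s]; split; rewrite ?size_map //.
    by rewrite map_inj_uniq // => x y [].
  by move=> _ /mapP[x xs ->]; apply: sk.
have scalar i (ci : central i) := central_scalar Ssimple unc ci.
have [b [v [hv vn kv]]] := exists_homog_killed ex.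
have [n hn] := L0_not_free Ssimple scalar l0 level hv vn kv.
have [x [a [[hx kx] xn xa]]] := L0_eigen hv vn kv hn.
exact: (eigen_highest_weight Ssimple scalar level hx kx xn xa).
Qed.
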